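(* Let $p$ be an odd prime and let $F$ be a field containing a primitive $p$th root of unity. Then $F$ is $p$-rigid if and only if $F^{(3)}=F^{\{3\}}$.
   Context: Write $\dot F=F\setminus\{0\}$, $\dot F^p$ for the group of nonzero $p$th powers, and $[a]_F=a\dot F^p\in\dot F/\dot F^p$. An element $a\in\dot F\setminus\dot F^p$ is called $p$-rigid if every element of the norm group $N_{F(\sqrt[p]{a})/F}\big(F(\sqrt[p]{a})^\times\big)$ lies in $\bigcup_{k=0}^{p-1}a^k\dot F^p$; the field $F$ is $p$-rigid if every element of $\dot F\setminus\dot F^p$ is $p$-rigid. All fields are taken inside a fixed separable closure of $F$. Let $F^{(2)}=F(\sqrt[p]{a}:a\in\dot F)$. Let $F^{\{3\}}$ be the compositum of all Galois extensions $K/F^{(2)}$ of degree $p$ (equivalently of all $F^{(2)}(\sqrt[p]{\gamma})$, $\gamma\in F^{(2)}\setminus\{0\}$), and let $F^{(3)}$ be the compositum of all Galois extensions $K/F^{(2)}$ of degree $p$ such that $K/F$ is also Galois. *)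

(* Defs.v *)
From HB Require Import structures.
From mathcomp Require Import all_boot all_order all_algebra all_field.
Set Implicit Arguments. Unset Strict Implicit. Unset Printing Implicit Defensive.
Import GRing.Theory.
Local Open Scope ring_scope.

(* Matrix of multiplication by x = sum_{i<p} c_i alpha^i on
   L = F(alpha), alpha^p = a, in the F-basis 1, alpha, ..., alpha^(p-1)
   (row j = coordinates of x * alpha^j).  Its determinant is N_{L/F}(x). *)
Definition normmx (F : fieldType) (p : nat) (a : F) (c : nat -> F) : 'M[F]_p :=
  \matrix_(j < p, k < p)
     (if (j <= k)%N then c (k - j)%N else a * c (k + p - j)%N).

Definition in_norm_group (F : fieldType) (p : nat) (a b : F) : Prop :=
  exists c : nat -> F, (exists i, (i < p)%N /\ c i != 0) /\ b = \det (normmx p a c).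

Definition p_rigid_elt (F : fieldType) (p : nat) (a : F) : Prop :=
  forall b, in_norm_group p a b ->
    exists k, (k < p)%N /\ exists d : F, d != 0 /\ b = a ^+ k * d ^+ p.

Definition p_rigid (F : fieldType) (p : nat) : Prop :=
  forall a : F, a != 0 -> ~ (exists b : F, a = b ^+ p) -> p_rigid_elt p a.

Definition is_subfield (L : fieldType) (S : L -> Prop) : Prop :=
  [/\ S 0, S 1, (forall x y, S x -> S y -> S (x - y)),
      (forall x y, S x -> S y -> S (x * y)) & (forall x, S x -> S x^-1)].

Definition gen (L : fieldType) (A : L -> Prop) : L -> Prop :=
  fun x => forall S, is_subfield S -> (forall y, A y -> S y) -> S x.

Definition is_sep_closure (F L : fieldType) (iota : {rmorphism F -> L}) : Prop :=
  (forall x : L, exists f : {poly F}, separable_poly f /\ root (map_poly iota f) x)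
  /\ (forall g : {poly L}, separable_poly g -> (1 < size g)%N -> exists x, root g x).

Definition inF (F L : fieldType) (iota : {rmorphism F -> L}) (y : L) : Prop :=
  exists a : F, y = iota a.

Definition galois_over (F L : fieldType) (iota : {rmorphism F -> L}) (K : L -> Prop) : Prop :=
  [/\ is_subfield K, (forall a : F, K (iota a)),
      (forall x, K x -> exists f : {poly F}, separable_poly f /\ root (map_poly iota f) x)
    & (forall f : {poly F}, irreducible_poly f -> forall x, K x ->
         root (map_poly iota f) x -> forall y, root (map_poly iota f) y -> K y)].

Definition F2 (F L : fieldType) (iota : {rmorphism F -> L}) (p : nat) : L -> Prop :=
  gen (fun y => inF iota y \/ exists a : F, a != 0 /\ y ^+ p = iota a).

Definition F3curly (F L : fieldType) (iota : {rmorphism F -> L}) (p : nat) : L -> Prop :=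
  gen (fun y => F2 iota p y \/
        exists g, [/\ F2 iota p g, g != 0 & y ^+ p = g]).

(* F^(3) = compositum of all K = F^(2)(gamma^(1/p)) of degree p over F^(2)
   (gamma not a p-th power in F^(2)) such that K/F is Galois *)
Definition F3 (F L : fieldType) (iota : {rmorphism F -> L}) (p : nat) : L -> Prop :=
  gen (fun y => F2 iota p y \/
        exists g, [/\ F2 iota p g, g != 0, y ^+ p = g,
                     ~ (exists h, F2 iota p h /\ g = h ^+ p)
                   & galois_over iota (gen (fun z => F2 iota p z \/ z = y))]).

(* Main.v *)
(* Write [z] for a primitive [p]-th root of unity and [K2 = F^(2)].

   If [F] is rigid, then so is, with respect to the elements of [F], every
   [S = F(a_1^(1/p), ..., a_n^(1/p))], and every element of [S^x] is, up to [p]-th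
   powers, a product of [p]-th roots of elements of [F].  For one step
   [D = S(al)], the group [J = D^x / D^xp] satisfies [J = A + (1 - s) J], where [A]
   is spanned by [al] and [S^x] (rigidity and Hilbert 90), and [(1 - s)^p = 0] on
   [J].  That [D] is again rigid is a statement on the norms of the bicyclic
   extension [D(ph)/S]; it follows from rigidity of all the [al^i ph^j] over [S] by
   means of the norm relation [sum_H N_H = N_G + p] over the subgroups [H] of order
   [p] of its group [G], and of the fact that a 2-cocycle of [G] with values in the
   span of three classes is inflated from a cyclic quotient of [G].
   Hence every [y] with [y^p] in [K2] is, up to a factor in [K2], a [p^2]-th root of
   an element of [F], and such roots generate Galois extensions of [F].

   Conversely, a [p]-th root [y] of an element [y^p] of [K2] lying in [F^(3)]
   satisfies [s y / y] in [K2] for every [s] in [Gal(L/F)].  For [x] in [F(al)], where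
   [al^p = a], this gives [s x / x = e k^p] with [e] in [F] and [k] in [F(al)], so that
   [N(x) = x^p e^(p(p-1)/2) (...)^p] is a [p]-th power in [F(al)] as [p] is odd; by
   Kummer theory it lies in [<a> F^xp]. *)
Require Import Defs.
From HB Require Import structures.
From mathcomp Require Import all_boot all_order all_algebra all_field.
From mathcomp Require Import boolp classical_sets ring.
Set Implicit Arguments. Unset Strict Implicit. Unset Printing Implicit Defensive.
Import GRing.Theory.
Local Open Scope ring_scope.

(** * Subfields given by propositions as [divringClosed] predicates *)

Definition subfield_pred (L : fieldType) (S : L -> Prop) of is_subfield S : {pred L} :=
  fun x => `[< S x >].

Lemma subfield_predP (L : fieldType) (S : L -> Prop) (hS : is_subfield S) x :
  reflect (S x) (x \in subfield_pred hS).
Proof. exact: asboolP. Qed.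

Lemma subfield_pred_divring (L : fieldType) (S : L -> Prop) (hS : is_subfield S) :
  divring_closed (subfield_pred hS).
Proof.
have [S0 S1 SB SM SV] := hS; split; first exact/subfield_predP.
  by move=> x y /subfield_predP Sx /subfield_predP Sy; apply/subfield_predP/SB.
move=> x y /subfield_predP Sx /subfield_predP Sy; apply/subfield_predP.
by apply: SM => //; apply: SV.
Qed.

HB.instance Definition _ (L : fieldType) (S : L -> Prop) (hS : is_subfield S) :=
  GRing.isDivringClosed.Build L (subfield_pred hS) (subfield_pred_divring hS).

Lemma divring_is_subfield (L : fieldType) (D : divringClosed L) :
  is_subfield (fun x => x \in D).
Proof.
split=> [|||x y|x]; rewrite ?rpred0 ?rpred1 //; first by move=> x y; apply: rpredB.
- exact: rpredM.
- by rewrite rpredV.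
Qed.

(** * Iterates of endomorphisms and norms of cyclic groups *)

(** Each iterate is packaged as a morphism, so that the lemmas on ring morphisms apply to it
    directly. *)
Fixpoint rpow (L : nzRingType) (t : {rmorphism L -> L}) (n : nat) : {rmorphism L -> L} :=
  if n is m.+1 then t \o rpow t m else idfun.
Arguments rpow : simpl never.

Section RPow.
Variables (L : nzRingType) (t : {rmorphism L -> L}).

Lemma rpow0 x : rpow t 0 x = x. Proof. by []. Qed.
Lemma rpowS n x : rpow t n.+1 x = t (rpow t n x). Proof. by []. Qed.
Lemma rpowD m n x : rpow t (m + n) x = rpow t m (rpow t n x).
Proof. by elim: m => // m IH; rewrite addSn !rpowS IH. Qed.
Lemma rpowSr n x : rpow t n.+1 x = rpow t n (t x).
Proof. by rewrite -addn1 rpowD. Qed.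
Lemma rpow_fix n x : t x = x -> rpow t n x = x.
Proof. by move=> tx; elim: n => // n IH; rewrite rpowS IH. Qed.
Lemma rpow_stable (D : {pred L}) n x : {in D, forall x, t x \in D} -> x \in D -> rpow t n x \in D.
Proof. by move=> tD Dx; elim: n => // n IH; rewrite rpowS tD. Qed.
Lemma rpow_eigen n z x : t z = z -> t x = z * x -> rpow t n x = z ^+ n * x.
Proof.
move=> tz tx; elim: n => [|n IH]; first by rewrite mul1r.
by rewrite rpowSr tx rmorphM IH rpow_fix // mulrA exprS.
Qed.
Lemma rpow_period p (D : {pred L}) n x :
  {in D, forall x, rpow t p x = x} -> x \in D -> rpow t (n * p) x = x.
Proof. by move=> tp Dx; elim: n => // n IH; rewrite mulSn rpowD IH tp. Qed.
End RPow.

Lemma rpow_comm (L : nzRingType) (g h : {rmorphism L -> L}) (D : {pred L}) m n x :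
  {in D, forall x, g x \in D} -> {in D, forall x, h x \in D} ->
  {in D, forall x, g (h x) = h (g x)} -> x \in D ->
  rpow g m (rpow h n x) = rpow h n (rpow g m x).
Proof.
move=> gD hD gh Dx.
have g1 k y : y \in D -> g (rpow h k y) = rpow h k (g y).
  by move=> Dy; elim: k => // k IH; rewrite !rpowS gh ?IH // rpow_stable.
by elim: m => // m IH; rewrite !rpowS IH g1 // rpow_stable.
Qed.

(** Endomorphisms of [L] stand for automorphisms of subfields: on a subfield where [t] has order
    [p], this is the norm to the elements fixed by [t]. *)
Definition pnorm (L : fieldType) (t : {rmorphism L -> L}) (p : nat) (x : L) :=
  \prod_(i < p) rpow t i x.

Section PNorm.
Variables (L : fieldType) (t : {rmorphism L -> L}) (p : nat).
Implicit Types x y : L.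

Lemma pnormM x y : pnorm t p (x * y) = pnorm t p x * pnorm t p y.
Proof. by rewrite -big_split; apply: eq_bigr => i _; rewrite rmorphM. Qed.
Lemma pnormV x : pnorm t p x^-1 = (pnorm t p x)^-1.
Proof. by rewrite -prodfV; apply: eq_bigr => i _; rewrite fmorphV. Qed.
Lemma pnormf_div x y : pnorm t p (x / y) = pnorm t p x / pnorm t p y.
Proof. by rewrite pnormM pnormV. Qed.
Lemma pnormX x n : pnorm t p (x ^+ n) = pnorm t p x ^+ n.
Proof. by rewrite -prodrXl; apply: eq_bigr => i _; rewrite rmorphXn. Qed.
Lemma pnorm_fix x : t x = x -> pnorm t p x = x ^+ p.
Proof.
move=> tx; rewrite /pnorm; under eq_bigr => i _ do rewrite rpow_fix //.
by rewrite prodr_const card_ord.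
Qed.
Lemma pnorm_neq0 x : x != 0 -> pnorm t p x != 0.
Proof. by move=> x0; apply/prodf_neq0 => i _; rewrite fmorph_eq0. Qed.
Lemma pnorm_in (D : divringClosed L) x :
  {in D, forall x, t x \in D} -> x \in D -> pnorm t p x \in D.
Proof. by move=> tD Dx; apply: rpred_prod => i _; apply: rpow_stable. Qed.
Lemma pnorm_fixed x : (0 < p)%N -> rpow t p x = x -> t (pnorm t p x) = pnorm t p x.
Proof.
rewrite /pnorm; case: p => // q _ tx; rewrite rmorph_prod big_ord_recr big_ord_recl /= mulrC.
by rewrite -rpowS tx; congr (_ * _); apply: eq_bigr.
Qed.

End PNorm.

Lemma pnorm_comm (L : fieldType) (g h : {rmorphism L -> L}) p (D : {pred L}) x :
  {in D, forall x, g x \in D} -> {in D, forall x, h x \in D} ->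
  {in D, forall x, g (h x) = h (g x)} -> x \in D ->
  g (pnorm h p x) = pnorm h p (g x).
Proof.
move=> gD hD gh Dx; rewrite rmorph_prod; apply: eq_bigr => i _.
exact: (rpow_comm 1 i gD hD gh).
Qed.

(** * Sums and products of roots of unity *)

Section RootsOfUnity.
Variables (L : fieldType) (p : nat) (z : L).
Hypotheses (zP : p.-primitive_root z).

Lemma sum_prim_expr s : (\sum_(j < p) z ^+ (s * j) = if (p %| s)%N then p%:R else 0).
Proof.
case: ifP => [ps | nps].
  rewrite (eq_bigr (fun=> 1)) => [|i _]; first by rewrite sumr_const card_ord.
  by apply/eqP; rewrite -(prim_order_dvd zP) dvdn_mulr.
have z1 : z ^+ s - 1 != 0 by rewrite subr_eq0 -(prim_order_dvd zP) nps.
apply: (mulfI z1); rewrite mulr0.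
under eq_bigr => i _ do rewrite exprM.
by rewrite -subrX1 -exprM mulnC exprM (prim_expr_order zP) expr1n subrr.
Qed.

(** The exponents add up to [p * p.-1./2] because [p] is odd. *)
Lemma prod_prim_expr : odd p -> \prod_(i < p) z ^+ i = 1.
Proof.
move=> op; rewrite -expr_sum -(big_mkord xpredT id) bin2_sum bin2odd //.
by rewrite exprM (prim_expr_order zP) expr1n.
Qed.

End RootsOfUnity.

(** * Hilbert 90 and eigenspaces for a cyclic action of order [p] *)

Section Hilbert90.
Variables (L : fieldType) (p : nat) (z : L) (t : {rmorphism L -> L}).
Variables (D : divringClosed L) (theta : L).
Hypotheses (zP : p.-primitive_root z) (op : odd p) (tz : t z = z).
Hypotheses (tD : {in D, forall x, t x \in D}) (tp : {in D, forall x, rpow t p x = x}).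
Hypotheses (Dtheta : theta \in D) (theta0 : theta != 0) (ttheta : t theta = z * theta).

Let p0 : (0 < p)%N. Proof. exact: prim_order_gt0 zP. Qed.

Lemma pnorm_eigen : pnorm t p theta = theta ^+ p.
Proof.
rewrite /pnorm; under eq_bigr => i _ do rewrite (rpow_eigen _ tz ttheta).
by rewrite big_split /= (prod_prim_expr zP op) mul1r prodr_const card_ord.
Qed.

Lemma eigen_pow_fixed : t (theta ^+ p) = theta ^+ p.
Proof. by rewrite rmorphXn ttheta exprMn (prim_expr_order zP) mul1r. Qed.

(** The Lagrange resolvents [Y c] satisfy [x * t (Y c) = Y c]. In place of independence of
    characters, an explicit combination of the [Y (theta ^+ j)] shows that one of them is
    nonzero. *)
Lemma hilbert90 x : x \in D -> pnorm t p x = 1 ->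
  exists y, [/\ y \in D, y != 0 & x = y / t y].
Proof.
move=> Dx Nx; have x0 : x != 0.
  apply: contra_eq_neq Nx => ->; case: p p0 => // q _.
  by rewrite /pnorm big_ord_recl rpow0 mul0r eq_sym oner_neq0.
pose A s := \prod_(i < s) rpow t i x.
pose Y c := \sum_(s < p) A s * rpow t s c.
have DA s : A s \in D by apply: rpred_prod => i _; apply: rpow_stable.
have DY c : c \in D -> Y c \in D.
  by move=> Dc; apply: rpred_sum => i _; rewrite rpredM ?rpow_stable.
have AS s : x * t (A s) = A s.+1.
  rewrite /A rmorph_prod [RHS]big_ord_recl rpow0; congr (_ * _); exact: eq_bigr.
have tY c : c \in D -> x * t (Y c) = Y c.
  move=> Dc; rewrite /Y rmorph_sum mulr_sumr.
  under eq_bigr => i _ do rewrite rmorphM mulrA AS -rpowS.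
  move: Nx (tp Dc); rewrite /pnorm -/(A p); case: p p0 => // q _ Aq tqc.
  rewrite big_ord_recr big_ord_recl Aq tqc /A big_ord0 !mul1r addrC.
  by congr (_ + _).
suff [j Yj] : exists j : 'I_p, Y (theta ^+ j) != 0.
  exists (Y (theta ^+ j)); split=> //; first by rewrite DY ?rpredX.
  have tYj : t (Y (theta ^+ j)) != 0 by rewrite fmorph_eq0.
  by apply: (mulIf tYj); rewrite divfK // tY ?rpredX.
apply: contrapT => noY.
(* Orthogonality of the powers of [z] leaves only the term [s = 0] of this sum, which is [p%:R]; it
   is nonzero because a primitive [p]-th root of unity exists. *)
have : \sum_(j < p) theta ^- j * Y (theta ^+ j) = 0.
  rewrite big1 // => j _; case: (eqVneq (Y (theta ^+ j)) 0) => [-> | Yj]; first by rewrite mulr0.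
  by case: noY; exists j.
have -> : \sum_(j < p) theta ^- j * Y (theta ^+ j) =
    \sum_(s < p) A s * \sum_(j < p) z ^+ (s * j).
  under [RHS]eq_bigr => s _ do rewrite mulr_sumr.
  rewrite exchange_big; apply: eq_bigr => j _; rewrite mulr_sumr; apply: eq_bigr => s _.
  rewrite mulrCA rmorphXn (rpow_eigen _ tz ttheta) exprMn -exprM [_ ^+ (s * j) * _]mulrC.
  by rewrite mulKf // expf_neq0.
rewrite (bigD1 (Ordinal p0)) //= [X in _ + X]big1 => [|s s0]; last first.
  by rewrite (sum_prim_expr zP) gtnNdvd ?mulr0 // lt0n.
rewrite (sum_prim_expr zP) dvdn0 addr0 /A big_ord0 mul1r => /eqP.
by rewrite (negPf (prim_root_natf_neq0 zP)).
Qed.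

(** [X j] is the projection of [x] to the eigenspace of [t] for [z ^+ j]; dividing by [theta ^+ j],
    which has the same eigenvalue, gives a fixed coefficient. *)
Lemma fixed_expansion x : x \in D -> exists e : nat -> L,
  (forall i, e i \in D /\ t (e i) = e i) /\ x = \sum_(i < p) e i * theta ^+ i.
Proof.
move=> Dx; pose c := (p%:R : L)^-1.
have Dzs : z \in D by have -> : z = t theta / theta; [rewrite ttheta mulfK | rewrite rpredM ?rpredV ?tD].
pose X j := c * \sum_(i < p) z ^- (i * j) * rpow t i x.
have DX j : X j \in D.
  rewrite rpredM ?rpredV ?rpredMn ?rpred1 // rpred_sum // => i _.
  by rewrite rpredM ?rpredV ?rpredX ?rpow_stable.
have tX j : t (X j) = z ^+ j * X j.
  rewrite /X rmorphM fmorphV rmorph_nat mulrCA; congr (_ * _).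
  rewrite rmorph_sum.
  have tzs i : t (z ^- (i * j) * rpow t i x) = z ^+ j * (z ^- (i.+1 * j) * rpow t i.+1 x).
    rewrite rmorphM fmorphV rmorphXn tz -rpowS mulrA; congr (_ * _).
    rewrite mulSn exprD invfM mulrA divff ?mul1r // expf_neq0 //.
    by rewrite (prim_root_eq0 zP) -lt0n.
  under eq_bigr => i _ do rewrite tzs.
  rewrite -mulr_sumr; congr (_ * _).
  move: (tp Dx) (prim_expr_order zP); case: p p0 => // q _ tqx zq.
  rewrite big_ord_recr big_ord_recl /= -rpowS tqx exprM zq expr1n mul0n expr0 addrC.
  by congr (_ + _).
exists (fun j => X j / theta ^+ j); split.
  move=> j; rewrite rpredM ?rpredV ?rpredX //; split=> //.
  rewrite fmorph_div tX rmorphXn ttheta exprMn -mulf_div divff ?mul1r //.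
  by rewrite expf_neq0 // (prim_root_eq0 zP) -lt0n.
under eq_bigr => i _ do rewrite divfK ?expf_neq0 //.
rewrite /X -mulr_sumr exchange_big /=.
have E (i : 'I_p) : \sum_(j < p) z ^- (i * j) * rpow t i x =
    (if (i : nat) == 0%N then p%:R else 0) * rpow t i x.
  rewrite -mulr_suml; congr (_ * _).
  have ziP : p.-primitive_root z^-1.
    rewrite -(_ : z ^+ p.-1 = z^-1); last first.
      by apply: (@mulIf _ z); rewrite ?(prim_root_eq0 zP) -?lt0n // mulVf ?(prim_root_eq0 zP) -?lt0n // -exprSr prednK // (prim_expr_order zP).
    by rewrite (prim_root_exp_coprime _ zP) coprimePn.
  under eq_bigr => j _ do rewrite -exprVn.
  rewrite (sum_prim_expr ziP); case: eqP => [-> | /eqP i0]; first by rewrite dvdn0.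
  by rewrite gtnNdvd // lt0n.
under eq_bigr => i _ do rewrite E.
rewrite (bigD1 (Ordinal p0)) //= [X in _ + X]big1 => [|i i0]; last by rewrite (negPf (_ : (i : nat) != 0%N)) ?mul0r.
by rewrite addr0 mulrA mulVf ?mul1r // (prim_root_natf_neq0 zP).
Qed.

End Hilbert90.

(** * The operator [1 - t] on the multiplicative group *)

Definition quo (L : fieldType) (t : {rmorphism L -> L}) (x : L) := x / t x.

Section Quo.
Variables (L : fieldType) (t : {rmorphism L -> L}).

Lemma quoE x : quo t x = x / t x. Proof. by []. Qed.
Lemma quoM x y : quo t (x * y) = quo t x * quo t y.
Proof. by rewrite /quo rmorphM mulf_div. Qed.
Lemma quo_neq0 x : x != 0 -> quo t x != 0.
Proof. by move=> x0; rewrite mulf_neq0 // invr_eq0 fmorph_eq0. Qed.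
Lemma iter_quoM n x y : iter n (quo t) (x * y) = iter n (quo t) x * iter n (quo t) y.
Proof. by elim: n => //= n ->; rewrite quoM. Qed.
Lemma iter_quoX n x k : iter n (quo t) (x ^+ k) = iter n (quo t) x ^+ k.
Proof.
elim: k => [|k IH]; last by rewrite !exprS iter_quoM IH.
by elim: n => //= n ->; rewrite /quo rmorph1 divr1.
Qed.
Lemma iter_quo_neq0 n x : x != 0 -> iter n (quo t) x != 0.
Proof. by move=> x0; elim: n => //= n; apply: quo_neq0. Qed.
Lemma iter_quo_in (D : divringClosed L) n x :
  {in D, forall x, t x \in D} -> x \in D -> iter n (quo t) x \in D.
Proof. by move=> tD Dx; elim: n => //= n IH; rewrite rpredM ?rpredV ?tD. Qed.
Lemma iter_quo_fixed n x : t x = x -> t (iter n (quo t) x) = iter n (quo t) x.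
Proof. by move=> tx; elim: n => //= n IH; rewrite quoE fmorph_div !IH. Qed.

Let e n i : int := (-1) ^+ i * 'C(n, i)%:R.

(** Binomial expansion of [(1 - t)^n], written multiplicatively. *)
Lemma iter_quoE n y : y != 0 ->
  iter n (quo t) y = \prod_(i < n.+1) rpow t i y ^ e n i.
Proof.
move=> y0; have ty0 i : rpow t i y != 0 by rewrite fmorph_eq0.
elim: n => [|n IH].
  by rewrite big_ord_recl big_ord0 /e bin0 mul1r expr1z mulr1.
have eS i : e n.+1 i.+1 = e n i.+1 - e n i.
  by rewrite /e binS natrD exprS mulN1r mulrDr !mulNr.
rewrite iterS quoE [RHS]big_ord_recl.
under [X in _ = _ * X]eq_bigr => i _ do rewrite eS expfzDr // -invr_expz.
rewrite big_split /= prodfV mulrA IH rmorph_prod; congr (_ / _); last first.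
  by apply: eq_bigr => i _; rewrite rmorphXz // unitfE.
rewrite big_ord_recl [in RHS]big_ord_recr /=.
have -> : e n n.+1 = 0 by rewrite /e bin_small // mulr0.
rewrite expr0z mulr1.
by rewrite /e !bin0.
Qed.

(* Modulo [p], [(1 - t)^p = 1 - t^p = 0]. *)
Lemma iter_quo_prime p (D : divringClosed L) y : prime p -> odd p ->
  {in D, forall x, t x \in D} -> y \in D -> y != 0 -> rpow t p y = y ->
  exists w, [/\ w \in D, w != 0 & iter p (quo t) y = w ^+ p].
Proof.
move=> pp op tD Dy y0 tpy; have ty0 i : rpow t i y != 0 by rewrite fmorph_eq0.
have Dty i : rpow t i y \in D by apply: rpow_stable.
case: p pp op tpy => // q pp op tpy.
exists (\prod_(i < q) rpow t i.+1 y ^ ((-1) ^+ i.+1 * ('C(q.+1, i.+1) %/ q.+1)%:R : int)); split.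
- apply: rpred_prod => i _; exact: rpredXz.
- by apply/prodf_neq0 => i _; rewrite expfz_neq0.
(* The two outer factors are [y] and, [p] being odd, [y^-1], and they cancel; the inner binomial
   coefficients are divisible by [p]. *)
rewrite iter_quoE // big_ord_recl big_ord_recr /= -rpowS tpy /e bin0 mul1r expr1z binn mulr1.
rewrite -signr_odd op mulrCA exprN1 mulfV // mulr1 -prodrXl; apply: eq_bigr => i _.
rewrite [RHS]exprnP exprz_exp -mulrA; congr (_ ^ (_ * _)).
by rewrite !natz -PoszM divnK // prime_dvd_bin //= ltnS ltn_ord.
Qed.
End Quo.

(** * Multiplicative structure of a cyclic extension with small norm group *)

Section NormGroup.
Variables (L : fieldType) (p : nat) (z : L) (t : {rmorphism L -> L}).
Variables (D : divringClosed L) (theta : L).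
Hypotheses (pp : prime p) (op : odd p) (zP : p.-primitive_root z) (tz : t z = z).
Hypotheses (tD : {in D, forall x, t x \in D}) (tp : {in D, forall x, rpow t p x = x}).
Hypotheses (Dtheta : theta \in D) (theta0 : theta != 0) (ttheta : t theta = z * theta).
Hypothesis normD : forall x, x \in D -> x != 0 -> exists k d,
  [/\ d \in D, d != 0, t d = d & pnorm t p x = (theta ^+ p) ^+ k * d ^+ p].

(* Modulo [p]-th powers, [D^x] is spanned by [theta], the fixed elements and the
   image of [quo t]; iterating [p] times kills the last summand. *)
Lemma norm_group_decomposition x : x \in D -> x != 0 -> exists k c d,
  [/\ c \in D, t c = c, d \in D & d != 0] /\ x = theta ^+ k * c * d ^+ p.
Proof.
have step y : y \in D -> y != 0 -> exists k c w,
    [/\ [/\ c \in D, c != 0 & t c = c], w \in D, w != 0 & y = theta ^+ k * c * quo t w].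
  move=> Dy y0; have [k [d [Dd d0 td Ny]]] := normD Dy y0.
  have u0 : theta ^+ k * d != 0 by rewrite mulf_neq0 ?expf_neq0.
  (* [theta ^+ k * d] has the same norm as [y], so Hilbert 90 applies to the quotient. *)
  have [||w [Dw w0 yE]] := hilbert90 zP tz tD tp Dtheta theta0 ttheta (x := y / (theta ^+ k * d)).
  - by rewrite rpredM ?rpredV ?rpredM ?rpredX.
  - rewrite pnormf_div Ny pnormM pnormX (pnorm_eigen zP op tz ttheta) (pnorm_fix _ td).
    by rewrite divff // mulf_neq0 ?expf_neq0.
  by exists k, d, w; split=> //; rewrite /quo -yE mulrC divfK.
have steps n y : y \in D -> y != 0 -> exists k c w,
    [/\ [/\ c \in D, c != 0 & t c = c], w \in D, w != 0 &
      y = theta ^+ k * c * iter n.+1 (quo t) w].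
  elim: n y => [|n IH] y Dy y0; first exact: step.
  have [k [c [w [[Dc c0 tc] Dw w0 yE]]]] := IH y Dy y0.
  have [k' [c' [w' [[Dc' c'0 tc'] Dw' w'0 wE]]]] := step w Dw w0.
  (* [quo t theta = z^-1] and [c'] are fixed by [t]; hence so are [v] and [v'], which are absorbed
     into the factor [c]. *)
  pose v := iter n.+1 (quo t) theta; pose v' := iter n.+1 (quo t) c'.
  have Dv : v \in D by apply: iter_quo_in.
  have Dv' : v' \in D by apply: iter_quo_in.
  have tv : t v = v.
    rewrite /v iterSr; apply: iter_quo_fixed.
    rewrite /quo ttheta invfM mulrCA divff // mulr1 fmorphV tz //.
  exists k, (c * v ^+ k' * v'), w'; split=> //.
    split; first exact: rpredM (rpredM Dc (rpredX _ Dv)) Dv'.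
      by rewrite (mulf_neq0 (mulf_neq0 c0 (expf_neq0 _ _))) ?iter_quo_neq0.
    have tv' : t v' = v' by apply: iter_quo_fixed.
    by rewrite (rmorphM t (c * _)) (rmorphM t c) rmorphXn tc tv tv'.
  by rewrite yE wE 2!iter_quoM iter_quoX -/v -/v' -iterSr !mulrA.
move=> Dx x0; have := steps p.-1 x Dx x0; rewrite prednK ?prime_gt0 //.
move=> [k [c [w [[Dc c0 tc] Dw w0 xE]]]].
have [d [Dd d0 dE]] := iter_quo_prime pp op tD Dw w0 (tp Dw).
by exists k, c, d; rewrite xE dE.
Qed.
End NormGroup.

(** * Norms of bicyclic extensions *)

Definition fixed_in (L : fieldType) (D : {pred L}) (s : {rmorphism L -> L}) : {pred L} :=
  [pred x | (x \in D) && (s x == x)].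

Lemma fixed_in_divring (L : fieldType) (D : divringClosed L) (s : {rmorphism L -> L}) :
  divring_closed (fixed_in D s).
Proof.
split; first by rewrite inE rpred1 rmorph1 /=.
- move=> x y /andP[Dx /eqP sx] /andP[Dy /eqP sy].
  by rewrite inE rpredB //= rmorphB sx sy.
- move=> x y /andP[Dx /eqP sx] /andP[Dy /eqP sy].
  by rewrite inE rpredM ?rpredV //= fmorph_div sx sy.
Qed.
HB.instance Definition _ (L : fieldType) (D : divringClosed L) (s : {rmorphism L -> L}) :=
  GRing.isDivringClosed.Build L (fixed_in D s) (fixed_in_divring D s).

Lemma fixed_inP (L : fieldType) (D : {pred L}) (s : {rmorphism L -> L}) x :
  reflect (x \in D /\ s x = x) (x \in fixed_in D s).
Proof. by apply: (iffP andP) => -[? /eqP]. Qed.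

Lemma pnorm_prod (L : fieldType) (t : {rmorphism L -> L}) p n (F : 'I_n -> L) :
  pnorm t p (\prod_i F i) = \prod_i pnorm t p (F i).
Proof. by rewrite /pnorm exchange_big; apply: eq_bigr => i _; rewrite rmorph_prod. Qed.

Lemma pnorm_shift (L : fieldType) (t : {rmorphism L -> L}) p n x :
  (0 < p)%N -> rpow t p x = x -> pnorm t p (rpow t n x) = pnorm t p x.
Proof.
move=> p0 tx; elim: n => // n IH; rewrite rpowS -IH.
have tnx : rpow t p (rpow t n x) = rpow t n x by rewrite -rpowD addnC rpowD tx.
rewrite -[RHS](pnorm_fixed p0 tnx) rmorph_prod; apply: eq_bigr => i _.
by rewrite -rpowSr.
Qed.

Lemma rpow_mod (L : fieldType) (t : {rmorphism L -> L}) p n x :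
  rpow t p x = x -> rpow t (n %% p) x = rpow t n x.
Proof.
move=> tx; rewrite [in RHS](divn_eq n p) addnC rpowD; congr (rpow t _ _).
by elim: (n %/ p)%N => // k IH; rewrite mulSn rpowD -IH tx.
Qed.

(** Multiplication by [i] permutes the residues modulo [p]. *)
Lemma pnorm_multiple (L : fieldType) (t : {rmorphism L -> L}) p i x :
  prime p -> ~~ (p %| i)%N -> rpow t p x = x ->
  \prod_(m < p) rpow t (m * i) x = pnorm t p x.
Proof.
move=> pp pi tx; have p0 := prime_gt0 pp.
pose f (m : 'I_p) : 'I_p := Ordinal (ltn_pmod (m * i) p0).
have f_inj : injective f.
  move=> m n /(congr1 val) /= /eqP; rewrite -!(mulnC i) => mn; apply/val_inj => /=.
  move: mn; wlog le_mn : m n / (m <= n)%N.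
    by move=> W mn; case: (leqP m n) => [/W/(_ mn) | /ltnW/W]; last by rewrite eq_sym => /(_ mn)->.
  rewrite eq_sym eqn_mod_dvd ?leq_mul2l ?le_mn ?orbT // -mulnBr Gauss_dvdr ?prime_coprime //.
  move=> pd; apply/eqP; rewrite eqn_leq le_mn /= -subn_eq0.
  move: pd; case: (posnP (n - m)) => [-> // | nm0 /(dvdn_leq nm0)].
  by rewrite leqNgt (leq_ltn_trans (leq_subr _ _)).
rewrite [RHS](reindex_inj f_inj); apply: eq_bigr => m _.
by rewrite -(rpow_mod _ tx).
Qed.

Section Bicyclic.
Variables (L : fieldType) (p : nat) (z : L) (M : divringClosed L).
Hypotheses (pp : prime p) (op : odd p) (zP : p.-primitive_root z).
Let p0 : (0 < p)%N := prime_gt0 pp.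

(** In the intended use [g] and [h] generate the group of [M] over a base field, [theta] generates
    over that base the intermediate field fixed by [s], and [t] generates the Galois group of this
    intermediate field; its norms are then confined to the classes of the powers of [theta ^+ p]. *)
Definition rigid_line (g h s t : {rmorphism L -> L}) (theta : L) :=
  forall x, x \in M -> x != 0 -> s x = x -> exists k d,
    [/\ d \in M, d != 0, g d = d & h d = d] /\ pnorm t p x = (theta ^+ p) ^+ k * d ^+ p.

(* [M = K(al, ph)] with [al^p] and [ph^p] in the fixed field [K] of [g] and [h];
   [bi_line m] and [bi_line' m] say that [(al / ph^m)^p] and [(ph / al^m)^p] are
   rigid over [K]. *)
Record bicyclic (g h : {rmorphism L -> L}) (al ph : L) : Prop := Bicyclic {
  bi_gM : {in M, forall x, g x \in M};
  bi_hM : {in M, forall x, h x \in M};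
  bi_gp : {in M, forall x, rpow g p x = x};
  bi_hp : {in M, forall x, rpow h p x = x};
  bi_gh : {in M, forall x, g (h x) = h (g x)};
  bi_gz : g z = z;
  bi_hz : h z = z;
  bi_al : al \in M;
  bi_ph : ph \in M;
  bi_al0 : al != 0;
  bi_ph0 : ph != 0;
  bi_gal : g al = z * al;
  bi_hal : h al = al;
  bi_gph : g ph = ph;
  bi_hph : h ph = z * ph;
  bi_line : forall m, rigid_line g h (rpow g m \o h) g (al / ph ^+ m);
  bi_line' : forall m, rigid_line g h (rpow h m \o g) h (ph / al ^+ m) }.

Lemma bicyclic_sym g h al ph : bicyclic g h al ph -> bicyclic h g ph al.
Proof.
case=> gM hM gp hp gh gz hz Mal Mph al0 ph0 gal hal gph hph l l'; split=> //.
- by move=> x Mx; rewrite gh.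
- move=> m x Mx x0 sx; have [k [d [[? ? ? ?] ?]]] := l' m x Mx x0 sx; by exists k, d.
- move=> m x Mx x0 sx; have [k [d [[? ? ? ?] ?]]] := l m x Mx x0 sx; by exists k, d.
Qed.

Section Pair.
Variables (g h : {rmorphism L -> L}) (al ph : L) (B : bicyclic g h al ph).
Let gM := bi_gM B. Let hM := bi_hM B. Let gp := bi_gp B. Let hp := bi_hp B.
Let gh := bi_gh B. Let gz := bi_gz B. Let hz := bi_hz B.
Let Mal := bi_al B. Let Mph := bi_ph B. Let al0 := bi_al0 B. Let ph0 := bi_ph0 B.
Let gal := bi_gal B. Let hal := bi_hal B. Let gph := bi_gph B. Let hph := bi_hph B.

Let z0 : z != 0. Proof. by rewrite (prim_root_eq0 zP) -lt0n. Qed.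
Let Mz : z \in M.
Proof. by have -> : z = g al / al; [rewrite gal mulfK | rewrite rpredM ?rpredV ?gM]. Qed.

(** [<g>] is the one subgroup of order [p] not generated by some [g^m h]; it is found among the
    lines [bi_line'] at [m = 0]. *)
Lemma bi_line_inf : rigid_line g h g h ph.
Proof.
move=> x Mx x0 gx; have [k [d [? E]]] := bi_line' B (m := 0) Mx x0 gx.
by exists k, d; split=> //; rewrite E expr0 divr1.
Qed.

Lemma rpow_skew m i x : x \in M -> rpow (rpow g m \o h) i x = rpow g (m * i) (rpow h i x).
Proof.
move=> Mx; elim: i => [|i IH]; first by rewrite muln0.
rewrite rpowS IH /= -(rpow_comm (m * i) 1 gM hM gh) ?rpow_stable //.
by rewrite mulnS rpowD.
Qed.

Lemma pnorm_gh x : x \in M -> pnorm g p (pnorm h p x) = pnorm h p (pnorm g p x).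
Proof.
move=> Mx; rewrite pnorm_prod [RHS]pnorm_prod /pnorm exchange_big.
by apply: eq_bigr => i _; apply: eq_bigr => j _; rewrite (rpow_comm i j gM hM gh).
Qed.

Lemma pnorm_g_skew m x : x \in M ->
  pnorm g p (pnorm (rpow g m \o h) p x) = pnorm g p (pnorm h p x).
Proof.
move=> Mx; rewrite !pnorm_prod; apply: eq_bigr => i _.
by rewrite rpow_skew // pnorm_shift // gp // rpow_stable.
Qed.

(* The norm relation [sum_H N_H = N_G + p] over the subgroups [H] of order [p]. *)
Lemma pnorm_relation x : x \in M ->
  (\prod_(m < p) pnorm (rpow g m \o h) p x) * pnorm g p x =
  x ^+ p * pnorm g p (pnorm h p x).
Proof.
move=> Mx; rewrite pnorm_prod /pnorm exchange_big /=.
(* The exponent [i = 0] contributes [x ^+ p]. For any other [i], [m * i] runs through all residues,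
   which gives the norm of [h^i x] under [g]. *)
rewrite (bigD1 (Ordinal p0)) //= [X in _ = _ * X](bigD1 (Ordinal p0)) //=.
rewrite prodr_const card_ord -!mulrA; congr (_ * _); rewrite mulrC; congr (_ * _).
apply: eq_bigr => i i0; rewrite -[RHS]/(pnorm g p (rpow h i x)).
rewrite -(pnorm_multiple pp (i := i)) ?gp ?rpow_stable //; last by rewrite gtnNdvd ?lt0n.
by apply: eq_bigr => m _; rewrite rpow_skew.
Qed.

(** [pnorm s p x / c] has norm 1 under [t], so Hilbert 90 makes it [quo t y] with [y] fixed by [s].
    In the decomposition [y = theta^k c' d^p] the factor [c'] is killed by [quo t], and [theta^k]
    leaves a power of [z]. *)
Lemma norm_on_line (s t : {rmorphism L -> L}) theta x c :
  {in M, forall x, s x \in M} -> {in M, forall x, t x \in M} ->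
  {in M, forall x, rpow s p x = x} -> {in M, forall x, rpow t p x = x} ->
  {in M, forall x, s (t x) = t (s x)} -> t z = z ->
  {in M, forall x, g x = x -> h x = x -> s x = x /\ t x = x} ->
  theta \in M -> theta != 0 -> s theta = theta -> t theta = z * theta ->
  rigid_line g h s t theta ->
  [/\ c \in M, c != 0, g c = c & h c = c] ->
  x \in M -> x != 0 -> pnorm t p (pnorm s p x) = c ^+ p ->
  exists i v, [/\ v \in M, v != 0 & pnorm s p x = c * z ^+ i * v ^+ p].
Proof.
move=> sM tM sp tp st tz stK Mth th0 sth tth line [Mc c0 gc hc] Mx x0 NN.
have [sc tc] := stK c Mc gc hc.
pose D : divringClosed L := fixed_in M s.
have DP y : reflect (y \in M /\ s y = y) (y \in D) by apply: fixed_inP.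
have tD : {in D, forall y, t y \in D}.
  by move=> y /DP[My sy]; apply/DP; rewrite tM // st // sy.
have tpD : {in D, forall y, rpow t p y = y} by move=> y /DP[My _]; rewrite tp.
have Dth : theta \in D by apply/DP.
have Dc : c \in D by apply/DP.
have Dw : pnorm s p x \in D.
  by apply/DP; rewrite pnorm_in ?pnorm_fixed // sp.
have [||y [Dy y0 yE]] := hilbert90 zP tz tD tpD Dth th0 tth (x := pnorm s p x / c).
- by rewrite rpredM ?rpredV.
- by rewrite pnormf_div NN (pnorm_fix _ tc) divff // expf_neq0.
have normD u : u \in D -> u != 0 -> exists k d,
  [/\ d \in D, d != 0, t d = d & pnorm t p u = (theta ^+ p) ^+ k * d ^+ p].
  move=> /DP[Mu su] u0; have [k [d [[Md d0 gd hd] E]]] := line u Mu u0 su.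
  by have [sd td] := stK d Md gd hd; exists k, d; split=> //; apply/DP.
have [k [c' [d [[Dc' tc' Dd d0] yE']]]] :=
  norm_group_decomposition pp op zP tz tD tpD Dth th0 tth normD Dy y0.
have [Md sd] := DP _ Dd; have td0 : t d != 0 by rewrite fmorph_eq0.
(* The exponent [k * p.-1] stands for [-k] modulo [p]. *)
exists (k * p.-1)%N, (d / t d); split; first by rewrite rpredM ?rpredV ?tM.
  by rewrite mulf_neq0 ?invr_eq0.
have zk : z ^+ (k * p.-1) = z ^- k.
  rewrite exprM exprAC; apply: (mulIf (expf_neq0 k z0)).
  by rewrite -exprMn -exprSr prednK // (prim_expr_order zP) expr1n mulVf ?expf_neq0.
have c'0 : c' != 0 by apply: contraNneq y0 => c'0; rewrite yE' c'0 mulr0 mul0r.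
rewrite -[LHS](divfK c0) yE yE' !rmorphM !rmorphXn tth tc' zk expr_div_n.
have := expf_neq0 k z0; have := expf_neq0 k th0; have := expf_neq0 p td0.
rewrite exprMn; move: (z ^+ k) (theta ^+ k) (t d ^+ p) (d ^+ p) => zk' thk tdp dp ? ? ?.
by field; apply/and4P.
Qed.
(** Both [g] and [h] multiply [r] by powers of [z], and a monomial in [al] and [ph] has the same
    eigenvalues. *)
Lemma kummer_bicyclic r : r \in M -> r != 0 -> g (r ^+ p) = r ^+ p -> h (r ^+ p) = r ^+ p ->
  exists j k e, [/\ e \in M, e != 0, g e = e & h e = e] /\ r = al ^+ j * ph ^+ k * e.
Proof.
move=> Mr r0 gr hr.
have eig (t : {rmorphism L -> L}) : t (r ^+ p) = r ^+ p -> exists j : nat, t r = z ^+ j * r.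
  rewrite rmorphXn => tr; have : (t r / r) ^+ p = 1 by rewrite expr_div_n tr divff // expf_neq0.
  by move=> /(prim_rootP zP) [j E]; exists j; rewrite -E divfK.
have [j gj] := eig g gr; have [k hk] := eig h hr.
have zn n : z ^+ n != 0 by rewrite expf_neq0.
exists j, k, (r / (al ^+ j * ph ^+ k)).
have u0 : al ^+ j * ph ^+ k != 0 by rewrite mulf_neq0 ?expf_neq0.
split; last by rewrite mulrC divfK.
split; first by rewrite rpredM ?rpredV ?rpredM ?rpredX.
- by rewrite mulf_neq0 ?invr_eq0.
- by rewrite fmorph_div rmorphM !rmorphXn gal gph gj exprMn -[X in _ / X]mulrA -mulf_div divff ?mul1r.
- by rewrite fmorph_div rmorphM !rmorphXn hal hph hk exprMn [X in _ / X]mulrCA -mulf_div divff ?mul1r.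
Qed.

(* Each [N_H x] is [c] up to a power of [z] and a [p]-th power of [M], so that the norm
   relation makes [c z^i] a [p]-th power of [M] for some [i]. *)
Lemma norm_in_base x c : x \in M -> x != 0 -> pnorm h p x = c ->
  [/\ c \in M, c != 0, g c = c & h c = c] -> exists i j k e,
  [/\ e \in M, e != 0, g e = e & h e = e] /\
  c = z ^+ i * (al ^+ j * ph ^+ k * e) ^+ p.
Proof.
move=> Mx x0 Nx cK; have [Mc c0 gc hc] := cK.
have NG : pnorm g p (pnorm h p x) = c ^+ p by rewrite Nx (pnorm_fix _ gc).
have lines (m : 'I_p) : exists iv : nat * L, [/\ iv.2 \in M, iv.2 != 0 &
    pnorm (rpow g m \o h) p x = c * z ^+ iv.1 * iv.2 ^+ p].
  suff [i [v ?]] : exists i v, [/\ v \in M, v != 0 &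
      pnorm (rpow g m \o h) p x = c * z ^+ i * v ^+ p] by exists (i, v).
  apply: (@norm_on_line (rpow g m \o h) g (al / ph ^+ m)) => //.
  - by move=> y My; rewrite /= rpow_stable ?hM.
  - by move=> y My; rewrite rpow_skew // hp // (rpow_period _ gp).
  - by move=> y My; rewrite /= -gh // -rpowSr.
  - by move=> y My gy hy; rewrite /= hy rpow_fix.
  - by rewrite rpredM ?rpredV ?rpredX.
  - by rewrite mulf_neq0 ?invr_eq0 ?expf_neq0.
  - rewrite /= fmorph_div rmorphXn hal hph exprMn fmorph_div (rpow_eigen _ gz gal).
    rewrite rmorphM !rmorphXn /= (rpow_fix _ gz) (rpow_fix _ gph).
    by rewrite -mulf_div divff ?mul1r ?expf_neq0.
  - by rewrite fmorph_div gal rmorphXn gph mulrA.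
  - exact: bi_line.
  - by rewrite pnorm_g_skew.
have [f fP] := choice lines.
have [i [v [Mv v0 gE]]] : exists i v, [/\ v \in M, v != 0 &
    pnorm g p x = c * z ^+ i * v ^+ p].
  apply: (@norm_on_line g h ph) => //; first exact: bi_line_inf.
  by rewrite -pnorm_gh.
pose I := (\sum_m (f m).1 + i)%N; pose V := \prod_m (f m).2 * v.
have V0 : V != 0 by rewrite mulf_neq0 //; apply/prodf_neq0 => m _; case: (fP m).
have MV : V \in M by rewrite rpredM // rpred_prod // => m _; case: (fP m).
(* The norm relation now reads [c ^+ p.+1 * z ^+ I * V ^+ p = x ^+ p * c ^+ p]. *)
have E : c * z ^+ I = (x / V) ^+ p.
  have := pnorm_relation Mx; rewrite NG gE.
  under eq_bigr => m _ do (case: (fP m) => _ _ ->).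
  rewrite !big_split /= prodr_const card_ord -expr_sum prodrXl => R.
  rewrite expr_div_n; apply: (mulIf (expf_neq0 p V0)); rewrite divfK ?expf_neq0 //.
  apply: (mulIf (expf_neq0 p c0)); rewrite -R /I /V exprD exprMn.
  by ring.
have u0 : x / V != 0 by rewrite mulf_neq0 ?invr_eq0.
have [||||j [k [e [eK rE]]]] := kummer_bicyclic (r := x / V) => //.
- by rewrite rpredM ?rpredV.
- by rewrite -E rmorphM rmorphXn gc gz.
- by rewrite -E rmorphM rmorphXn hc hz.
exists (I * p.-1)%N, j, k, e; split=> //; rewrite -rE -E mulrCA -exprD addnC -mulnS.
by rewrite prednK // mulnC exprM (prim_expr_order zP) expr1n mulr1.
Qed.

End Pair.
Section Final.
Variables (g h : {rmorphism L -> L}) (al ph : L) (B : bicyclic g h al ph).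
Let gM := bi_gM B. Let hM := bi_hM B. Let gp := bi_gp B. Let hp := bi_hp B.
Let gh := bi_gh B. Let gz := bi_gz B. Let hz := bi_hz B.
Let Mal := bi_al B. Let Mph := bi_ph B. Let al0 := bi_al0 B. Let ph0 := bi_ph0 B.
Let gal := bi_gal B. Let hal := bi_hal B. Let gph := bi_gph B. Let hph := bi_hph B.
Let hg : {in M, forall x, h (g x) = g (h x)}. Proof. by move=> x Mx; rewrite gh. Qed.

Let z0 : z != 0. Proof. by rewrite (prim_root_eq0 zP) -lt0n. Qed.

(* The relations [quo g x = quo h y], [N_h x = z] and [N_g y = z^i al^pj ph^pk e^p]
   express that a 2-cocycle of [<g, h>] splits.  Adjusting [x] and [y] by powers of
   [al] and [ph] and replacing [g] by [g' = h^m g] makes [N_g' y = 1]; Hilbert 90 for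
   [g'] then turns [x] into an element fixed by [g'], to which rigidity applies. *)
Lemma root_of_unity_norm x : x \in M -> x != 0 -> pnorm h p x = z ->
  exists k d, [/\ d \in M, d != 0, h d = d & z = (ph ^+ p) ^+ k * d ^+ p].
Proof.
move=> Mx x0 Nx.
have Mquo (t : {rmorphism L -> L}) y : {in M, forall x, t x \in M} -> y \in M -> quo t y \in M.
  by move=> tM My; rewrite rpredM ?rpredV ?tM.
have [|y [My y0 yE]] := hilbert90 zP hz hM hp Mph ph0 hph (Mquo g x gM Mx).
  by rewrite pnormf_div -(pnorm_comm p gM hM gh Mx) Nx gz divff.
(* [quo h y = quo g x] has norm 1 under [g], so the norm of [y] under [g] is fixed by [h] as
   well. *)
have NgyK : [/\ pnorm g p y \in M, pnorm g p y != 0, h (pnorm g p y) = pnorm g p y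
    & g (pnorm g p y) = pnorm g p y].
  have Ny0 := pnorm_neq0 g p y0.
  split=> //; [exact: pnorm_in | | by rewrite pnorm_fixed ?gp].
  have : pnorm g p (quo h y) = 1.
    rewrite -[quo h y]/(y / h y) -yE pnormf_div.
    by rewrite (pnorm_shift 1 p0 (gp Mx) : pnorm g p (g x) = _) divff ?pnorm_neq0.
  rewrite pnormf_div -(pnorm_comm p hM gM hg My) => /(congr1 ( *%R^~ (h (pnorm g p y)))).
  by rewrite divfK ?mul1r // fmorph_eq0.
have [i [k [j [e [[Me e0 he ge] NyE]]]]] := norm_in_base (bicyclic_sym B) My y0 erefl NgyK.
(* Dividing [y] by the bracketed root leaves the norm [z ^+ i]. The factor [al ^- k] of [x2]
   preserves the relation between the two quotients, at the price of changing the norm [z] into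
   [b]. *)
pose x2 := x / al ^+ k; pose y2 := y / (al ^+ j * e) / ph ^+ k.
have Mx2 : x2 \in M by rewrite rpredM ?rpredV ?rpredX.
have My2 : y2 \in M by rewrite !rpredM ?rpredV ?rpredM ?rpredX.
have x20 : x2 != 0 by rewrite mulf_neq0 ?invr_eq0 ?expf_neq0.
have y20 : y2 != 0 by rewrite !mulf_neq0 ?invr_eq0 ?mulf_neq0 ?expf_neq0.
have quo_eigen (t : {rmorphism L -> L}) u n :
    u != 0 -> t u = z * u -> quo t (u ^+ n)^-1 = z ^+ n.
  move=> u0 tu; rewrite /quo fmorphV rmorphXn tu exprMn invrK mulrCA mulVf ?mulr1 //.
  by rewrite expf_neq0.
have quo2 : quo g x2 = quo h y2.
  rewrite /x2 /y2 quoM (quoM h (y / _)) (quoM h y) !quo_eigen // [quo g x]yE; congr (_ * _).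
  rewrite [quo h (_^-1)]quoE fmorphV rmorphM rmorphXn hal he divff ?mulr1 //.
  by rewrite invr_eq0 mulf_neq0 ?expf_neq0.
pose b := z / (al ^+ p) ^+ k.
have Nx2 : pnorm h p x2 = b.
  by rewrite pnormf_div Nx pnormX (pnorm_fix _ hal).
have Ny2 : pnorm g p y2 = z ^+ i.
  rewrite !pnormf_div NyE pnormM !pnormX (pnorm_eigen zP op gz gal) (pnorm_fix _ ge) (pnorm_fix _ gph).
  have := expf_neq0 p al0; have := expf_neq0 p ph0; have := expf_neq0 p e0.
  rewrite !exprMn -!exprM (mulnC j) (mulnC k) !exprM => e0' ph0' al0'.
  have := expf_neq0 j al0'; have := expf_neq0 k ph0'.
  move: ((al ^+ p) ^+ j) ((ph ^+ p) ^+ k) (e ^+ p) (z ^+ i) e0' => A P E Z ? ? ?.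
  by field; apply/and3P.
clearbody x2 y2.
(* [m] is [-i] modulo [p], so that [z ^+ m] will cancel the [z ^+ i] left in the norm. [A] is the
   cocycle of partial norms of [x2] under [h]. *)
pose m := (i * p.-1)%N; pose g' : {rmorphism L -> L} := rpow h m \o g.
pose A n := \prod_(s < n) rpow h s x2.
have MA n : A n \in M by apply: rpred_prod => s _; apply: rpow_stable.
have A0 n : A n != 0 by apply/prodf_neq0 => s _; rewrite fmorph_eq0.
have AS n : A n.+1 = A n * rpow h n x2 by rewrite /A big_ord_recr.
have AD n n' : A (n + n')%N = A n * rpow h n (A n').
  elim: n' => [|n' IH]; first by rewrite addn0 {3}/A big_ord0 rmorph1 mulr1.
  by rewrite addnS !AS IH rmorphM mulrA rpowD.
have AP : A (m * p)%N = b ^+ m.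
  elim: (m) => [|n IH]; first by rewrite /A big_ord0.
  by rewrite mulSn AD hp // IH exprS -Nx2.
(* The correction is dictated by [A m / h (A m) = x2 / h^m x2]: it carries the relation between [g]
   and [h] over to [g'] and [h]. *)
pose y3 := y2 * g (A m).
have My3 : y3 \in M := rpredM My2 (gM (MA m)).
have quo3 : quo g' x2 = quo h y3.
  rewrite (quoM h y2) -quo2 [quo h (g _)]quoE -gh // -fmorph_div.
  have -> : A m / h (A m) = x2 / rpow h m x2.
    apply/eqP; rewrite eqr_div ?fmorph_eq0 //; apply/eqP; rewrite -AS /A big_ord_recl.
    by rewrite rmorph_prod; congr (_ * _); apply: eq_bigr.
  rewrite /quo /= fmorph_div mulrA divfK ?fmorph_eq0 //; congr (_ / _).
  exact/esym/(rpow_comm 1 m gM hM gh).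
have hy2 n : rpow h n y2 = y2 * (g (A n) / A n).
  elim: n => [|n IH]; first by rewrite /A big_ord0 rmorph1 divff ?mulr1 ?oner_neq0.
  have hy : h y2 = y2 * (g x2 / x2).
    apply: (mulIf x20); rewrite mulrA divfK //.
    have h0 : h y2 != 0 by rewrite fmorph_eq0.
    have g0 : g x2 != 0 by rewrite fmorph_eq0.
    by move/eqP: quo2; rewrite /quo eqr_div // => /eqP E; rewrite mulrC E.
  rewrite rpowSr hy rmorphM IH AS fmorph_div -(rpow_comm 1 n gM hM gh Mx2 : g _ = _).
  rewrite rmorphM; have := A0 n; have : rpow h n x2 != 0 by rewrite fmorph_eq0.
  move: (g (A n)) (A n) (rpow h n x2) (g (rpow h n x2)) => ga a u gu ? ?.
  by field; apply/andP.
have Ny3 : pnorm g' p y3 = ((al ^+ k) ^+ p) ^- m.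
  (* The factors by which [g'^n y3] differs from [g^n y2] telescope, leaving
     [A (m * p) = b ^+ m]. *)
  pose Bq n := rpow g n (A (m * n)%N).
  have B0 n : Bq n != 0 by rewrite fmorph_eq0.
  have term n : rpow g' n y3 = rpow g n y2 * (Bq n.+1 / Bq n).
    rewrite (rpow_skew (bicyclic_sym B)) //.
    have MgA : g (A m) \in M := gM (MA m).
    rewrite -(rpow_comm n (m * n) gM hM gh); last exact: My3.
    rewrite rmorphM hy2 -(rpow_comm 1 (m * n) gM hM gh (MA m) : g _ = _) -mulrA rmorphM; congr (_ * _).
    by rewrite mulrAC -rmorphM -AD -mulnSr fmorph_div -rpowSr.
  rewrite /pnorm; under eq_bigr => n _ do rewrite term.
  rewrite big_split /= -[X in X * _]/(pnorm g p y2) Ny2.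
  rewrite -(big_mkord xpredT (fun n => Bq n.+1 / Bq n)) telescope_prodf ?p0 //.
  rewrite /Bq muln0 [A 0%N]big_ord0 rmorph1 divr1 gp // AP /b expr_div_n mulrA.
  have -> : z ^+ i * z ^+ m = 1.
    by rewrite -exprD -mulnS prednK // mulnC exprM (prim_expr_order zP) expr1n.
  by rewrite mul1r (exprAC _ p).
have g'M : {in M, forall u, g' u \in M} by move=> u Mu; rewrite /= rpow_stable ?gM.
have g'p : {in M, forall u, rpow g' p u = u}.
  by move=> u Mu; rewrite (rpow_skew (bicyclic_sym B)) // gp // (rpow_period _ hp).
have g'h : {in M, forall u, g' (h u) = h (g' u)}.
  by move=> u Mu; rewrite /= gh // -rpowSr.
have g'z : g' z = z by rewrite /= gz rpow_fix.
have g'al : g' al = z * al by rewrite /= gal rmorphM !rpow_fix.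
have [||t [Mt t0 tE]] := hilbert90 zP g'z g'M g'p Mal al0 g'al (x := y3 * (al ^+ k) ^+ m).
- by rewrite rpredM // !rpredX.
- rewrite pnormM Ny3 !pnormX (pnorm_eigen zP op g'z g'al) (exprAC _ p k) mulVf //.
  by rewrite !expf_neq0.
have quo_h : quo h (y3 * (al ^+ k) ^+ m) = quo h y3.
  by rewrite quoM [quo h (_ ^+ m)]quoE !rmorphXn hal divff ?mulr1 ?expf_neq0.
(* [quo h t] has norm 1 under [h] and the same image under [quo g'] as [x2]; dividing by it keeps
   the norm [b] and makes the result fixed by [g']. *)
pose w := x2 / quo h t.
have Mht := Mquo h t hM Mt.
have ht0 : quo h t != 0 by apply: quo_neq0.
have g'w : g' w = w.
  have : quo g' x2 = quo g' (quo h t).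
    rewrite quo3 -quo_h tE !quoE !fmorph_div g'h //.
    have : h t != 0 by rewrite fmorph_eq0.
    have : g' t != 0 by rewrite fmorph_eq0.
    have : h (g' t) != 0 by rewrite !fmorph_eq0.
    move: (h t) (g' t) (h (g' t)) => a1 a2 a3 ? ? ?.
    by field; apply/and3P.
  move/eqP; rewrite [X in X == _]quoE [X in _ == X]quoE eqr_div ?fmorph_eq0 // => /eqP E.
  by apply/eqP; rewrite /w fmorph_div eqr_div ?fmorph_eq0 // E mulrC.
have Nw : pnorm h p w = b.
  rewrite pnormf_div Nx2 pnormf_div (pnorm_shift 1 p0 (hp Mt) : pnorm h p (h t) = _).
  by rewrite divff ?divr1 // pnorm_neq0.
have [||k' [d [[Md d0 gd hd] E]]] := bi_line' B (m := m) (x := w) _ _ g'w.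
- by rewrite rpredM ?rpredV.
- by rewrite mulf_neq0 ?invr_eq0.
have alm0 : al ^+ m != 0 by rewrite expf_neq0.
exists k', (d * al ^+ k / (al ^+ m) ^+ k'); split.
- by rewrite !rpredM ?rpredV ?rpredX // !rpredX.
- by rewrite !mulf_neq0 ?invr_eq0 ?expf_neq0.
- by rewrite fmorph_div rmorphM !rmorphXn hal hd.
have al_p : (al ^+ p) ^+ k != 0 by rewrite !expf_neq0.
rewrite -[LHS](divfK al_p) -/b -Nw E !(exprAC _ p) -!exprMn; congr (_ ^+ p).
by rewrite expr_div_n; ring.
Qed.

(** The norm is first decomposed as [al^l c d^p] inside the field fixed by [h]. Once [p] is known to
    divide [l], the norm of [x / d] lies in the base and [norm_in_base] applies; if the remaining
    power of [z] is nontrivial, then [z] is itself a norm and [root_of_unity_norm] absorbs it. *)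
Theorem bicyclic_norm x : x \in M -> x != 0 -> exists k d,
  [/\ d \in M, d != 0, h d = d & pnorm h p x = (ph ^+ p) ^+ k * d ^+ p].
Proof.
move=> Mx x0.
pose D : divringClosed L := fixed_in M h.
have DP y : reflect (y \in M /\ h y = y) (y \in D) by apply: fixed_inP.
have gD : {in D, forall y, g y \in D}.
  by move=> y /DP[My hy]; apply/DP; rewrite gM // -gh // hy.
have gpD : {in D, forall y, rpow g p y = y} by move=> y /DP[My _]; rewrite gp.
have Dal : al \in D by apply/DP.
have Dy : pnorm h p x \in D by apply/DP; rewrite pnorm_in // pnorm_fixed // hp.
have normD u : u \in D -> u != 0 -> exists k d,
  [/\ d \in D, d != 0, g d = d & pnorm g p u = (al ^+ p) ^+ k * d ^+ p].
  move=> /DP[Mu su] u0; have [k [d [[Md d0 gd hd] E]]] := bi_line B (m := 0) Mu u0 su.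
  by exists k, d; rewrite E expr0 divr1; split=> //; apply/DP.
have [l [c [d [[Dc gc Dd d0] yE]]]] :=
  norm_group_decomposition pp op zP gz gD gpD Dal al0 gal normD Dy (pnorm_neq0 h p x0).
have [Mc hc] := DP _ Dc; have [Md hd] := DP _ Dd.
have c0 : c != 0.
  by apply: contraNneq (pnorm_neq0 h p x0) => c0; rewrite yE c0 mulr0 mul0r.
have Mx1 : x / d \in M by rewrite rpredM ?rpredV.
have x10 : x / d != 0 by rewrite mulf_neq0 ?invr_eq0.
have Nx1 : pnorm h p (x / d) = al ^+ l * c.
  by rewrite pnormf_div yE (pnorm_fix _ hd) mulfK // expf_neq0.
(* After a further norm under [g], rigidity of the line [<g>] gives [al^l c = z^s ph^k e]; applying
   [g] to both sides yields [z ^+ l = 1]. *)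
have [q lE] : exists q, l = (q * p)%N.
  apply/dvdnP; have Mg : pnorm g p (x / d) \in M by apply: pnorm_in.
  have gNg : g (pnorm g p (x / d)) = pnorm g p (x / d) by rewrite pnorm_fixed ?gp.
  have [k [e [[Me e0 ge he] E]]] := bi_line_inf B Mg (pnorm_neq0 _ _ x10) gNg.
  move: E; rewrite -(pnorm_gh B) // Nx1 pnormM pnormX (pnorm_eigen zP op gz gal) (pnorm_fix _ gc).
  rewrite !(exprAC _ p) -!exprMn => E.
  have v0 : ph ^+ k * e != 0 by rewrite mulf_neq0 ?expf_neq0.
  have : (al ^+ l * c / (ph ^+ k * e)) ^+ p = 1 by rewrite expr_div_n E divff ?expf_neq0.
  move=> /(prim_rootP zP) [s /(canRL (divfK v0)) rE].
  have := congr1 g rE; rewrite !rmorphM !rmorphXn gal gc gz gph ge -rE exprMn -mulrA.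
  rewrite -[X in _ = X]mul1r => /(mulIf _) zl; rewrite (prim_order_dvd zP); apply/eqP/zl.
  by rewrite mulf_neq0 ?expf_neq0.
have alE : al ^+ l = (al ^+ p) ^+ q by rewrite lE mulnC exprM.
have galp : g (al ^+ p) = al ^+ p := eigen_pow_fixed zP gal.
have [|i [j [k [e [[Me e0 ge he] cE]]]]] := norm_in_base B Mx1 x10 Nx1.
  split; first by rewrite rpredM ?rpredX.
  - by rewrite mulf_neq0 ?expf_neq0.
  - by rewrite alE rmorphM rmorphXn galp gc.
  - by rewrite rmorphM rmorphXn hal hc.
have NxE : pnorm h p x = z ^+ i * (ph ^+ p) ^+ k * (d * al ^+ j * e) ^+ p.
  rewrite yE cE !exprMn -!exprM (mulnC k); ring.
have u0 : d * al ^+ j * e != 0 by rewrite !mulf_neq0 ?expf_neq0.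
have Mu : d * al ^+ j * e \in M by rewrite !rpredM ?rpredX.
have hu : h (d * al ^+ j * e) = d * al ^+ j * e by rewrite !rmorphM rmorphXn hal hd he.
have [pi | pi] := boolP (p %| i)%N.
  exists k, (d * al ^+ j * e); split=> //.
  by move: pi; rewrite NxE (prim_order_dvd zP) => /eqP ->; rewrite mul1r.
have [i' i'1] : exists i', (i * i' = 1 %[mod p])%N.
  have i0 : (0 < i)%N by rewrite lt0n; apply: contraNneq pi => ->; rewrite dvdn0.
  case: (egcdnP p i0) => i' q' E _.
  by exists i'; rewrite mulnC E gcdnC (eqP (_ : coprime p i)) ?prime_coprime // modnMDl.
(* The quotient has norm [z ^+ i], and [i'] inverts [i] modulo [p]. *)
pose x3 := (x / (ph ^+ k * (d * al ^+ j * e))) ^+ i'.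
have v0 : ph ^+ k * (d * al ^+ j * e) != 0 by rewrite mulf_neq0 ?expf_neq0.
have Nx3 : pnorm h p x3 = z.
  rewrite pnormX pnormf_div NxE pnormM pnormX (pnorm_eigen zP op hz hph) (pnorm_fix _ hu).
  rewrite -mulrA mulfK ?mulf_neq0 ?expf_neq0 //.
  by rewrite -exprM -(prim_expr_mod zP) i'1 (prim_expr_mod zP) expr1.
have [||k' [d' [Md' d'0 hd' zE]]] := root_of_unity_norm (x := x3) _ _ Nx3.
- by rewrite rpredX // rpredM ?rpredV // rpredM ?rpredX.
- by rewrite expf_neq0 // mulf_neq0 ?invr_eq0.
exists (k' * i + k)%N, (d' ^+ i * (d * al ^+ j * e)); split.
- by rewrite rpredM ?rpredX.
- by rewrite mulf_neq0 ?expf_neq0.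
- by rewrite rmorphM rmorphXn hd' hu.
rewrite NxE zE [X in X ^+ i]mulrC exprMn [in RHS]exprMn exprD -!exprM (mulnC i p) !exprM.
by ring.
Qed.

End Final.
End Bicyclic.

(** * Extension of morphisms to the separable closure *)

(** A subfield as a field type of its own, over which polynomial division and greatest common
    divisors are available. *)
Definition subfld (L : fieldType) (S : divringClosed L) : Type := {x : L | x \in S}.
HB.instance Definition _ (L : fieldType) (S : divringClosed L) := SubChoice.on (subfld S).
HB.instance Definition _ (L : fieldType) (S : divringClosed L) :=
  [SubChoice_isSubIntegralDomain of subfld S by <:].
HB.instance Definition _ (L : fieldType) (S : divringClosed L) :=
  [SubIntegralDomain_isSubField of subfld S by <:].

Definition subfld_val (L : fieldType) (S : divringClosed L) : {rmorphism subfld S -> L} := val.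
Arguments subfld_val {L S} : simpl never.

Lemma subfld_valP (L : fieldType) (S : divringClosed L) (u : subfld S) : subfld_val u \in S.
Proof. exact: valP. Qed.

Lemma subfld_lift (L : fieldType) (S : divringClosed L) x : x \in S ->
  exists u : subfld S, subfld_val u = x.
Proof. by move=> Sx; exists (Sub x Sx). Qed.

Lemma polyOver_lift (L : fieldType) (S : divringClosed L) (P : {poly L}) :
  P \is a polyOver S -> exists Q : {poly subfld S}, map_poly (subfld_val (S:=S)) Q = P.
Proof.
move=> /polyOverP SP; exists (\poly_(i < size P) (insubd 0 P`_i : subfld S)).
apply/polyP => i; rewrite coef_map coef_poly; case: ltnP => Pi; last first.
  by rewrite [RHS]nth_default //; exact: (rmorph0 subfld_val).
exact: insubdK.
Qed.

Lemma map_subfld_over (L : fieldType) (S : divringClosed L) (Q : {poly subfld S}) :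
  map_poly (subfld_val (S:=S)) Q \is a polyOver S.
Proof. by apply/polyOverP => i; rewrite coef_map; apply: valP. Qed.

Opaque subfld_val.

(** * Minimal polynomials *)

Section Minimal.
Variables (K L : fieldType) (i : {rmorphism K -> L}).
Local Notation "P ^i" := (map_poly i P) (at level 2, format "P ^i") : ring_scope.

Lemma exists_minimal_poly x : (exists P : {poly K}, P != 0 /\ root P^i x) ->
  exists q : {poly K}, [/\ q != 0, root q^i x & forall P : {poly K}, root P^i x -> q %| P].
Proof.
move=> algx; pose Pn n := `[< exists P : {poly K}, [/\ P != 0, root P^i x & size P = n] >].
have exn : exists n, Pn n.
  by case: algx => P [P0 Px]; exists (size P); apply/asboolP; exists P.
have [n /asboolP[q [q0 qx szq]] n_min] := ex_minnP exn.
exists q; split=> // P Px; apply/modp_eq0P/eqP/contraT => r0.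
have rx : root (P %% q)^i x.
  have E := divp_eq P q; move: Px.
  by rewrite {1}E rmorphD rmorphM !rootE hornerD hornerM (rootP qx) mulr0 add0r.
have := n_min (size (P %% q)); rewrite leqNgt -szq ltn_modp q0 => /(_ _)/negP[] //.
by apply/asboolP; exists (P %% q).
Qed.

(** The gcd does not vanish at [x], so its cofactor in [q] does; by minimality [q] divides this
    cofactor, and the gcd is constant. *)
Lemma minimal_poly_inverse q x (P : {poly K}) :
  (forall P : {poly K}, root P^i x -> q %| P) -> q != 0 -> root q^i x ->
  P^i.[x] != 0 -> exists U V : {poly K}, U * P + V * q = 1.
Proof.
move=> qmin q0 qx Px; suff /Bezout_eq1_coprimepP[[U V] E] : coprimep P q by exists U, V.
have [/divpK gq /divpK gP] := (dvdp_gcdr P q, dvdp_gcdl P q).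
have gx : (gcdp P q)^i.[x] != 0.
  by apply: contraNneq Px => gx; rewrite -gP rmorphM hornerM gx mulr0.
have : root (q %/ gcdp P q)^i x.
  by move: qx; rewrite -{1}gq rmorphM rootM => /orP[|/rootP /eqP]; last rewrite (negPf gx).
move/qmin; rewrite /coprimep.
have g0 : gcdp P q != 0 by rewrite gcdp_eq0 (negPf q0) andbF.
have h0 : q %/ gcdp P q != 0 by apply: contraNneq q0 => h0; rewrite -gq h0 mul0r.
move/(dvdp_leq h0); rewrite -{1}gq size_mul // (polySpred h0) (polySpred g0) addSn addnS /=.
by rewrite -[X in (_ <= X)%N]addn0 ltnS leq_add2l leqn0 => /eqP ->.
Qed.
End Minimal.

(** * Partial field morphisms as graphs *)

Section FieldGraph.
Variable L : fieldType.
Implicit Type R : set (L * L).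

(* Division is harmless in the last clause: [v.1 = 0] forces [v.2 = 0], and [x / 0 = 0]. *)
Definition field_graph R :=
  [/\ forall y, R (0, y) -> y = 0, R (1, 1) &
      forall u v, R u -> R v -> R (u.1 - v.1, u.2 - v.2) /\ R (u.1 / v.1, u.2 / v.2)].

(** The graph of the extension of [sigma] to [K(x)] sending [x] to [w]; for algebraic [x] polynomial
    values already exhaust [K(x)]. *)
Definition poly_graph (K : fieldType) (i sigma : {rmorphism K -> L}) (x w : L) : set (L * L) :=
  fun u => exists P, u = ((map_poly i P).[x], (map_poly sigma P).[w]).

(** An inverse of [Q] modulo the minimal polynomial of [x] has coefficients in [K], so it inverts
    the values of [Q] at [x] and at [w] simultaneously. *)
Lemma poly_graph_field (K : fieldType) (i sigma : {rmorphism K -> L}) (x w : L) :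
  (exists P, P != 0 /\ root (map_poly i P) x) ->
  (forall P, root (map_poly i P) x -> root (map_poly sigma P) w) ->
  field_graph (poly_graph i sigma x w).
Proof.
move=> algx hom; have [q [q0 qx qmin]] := exists_minimal_poly algx.
split.
- by move=> y [P [/esym/rootP/hom/rootP-> ->]].
- by exists 1; rewrite !rmorph1 !hornerC.
move=> _ _ [P ->] [Q ->] /=; split.
  by exists (P - Q); rewrite !rmorphB !hornerE.
have [Qx | Qx] := eqVneq (map_poly i Q).[x] 0.
  have := hom Q; rewrite !rootE Qx => /(_ (eqxx _))/eqP ->.
  by exists 0; rewrite !invr0 !mulr0 !rmorph0 !horner0.
have [U [V E]] := minimal_poly_inverse qmin q0 qx Qx.
have inv (j : {rmorphism K -> L}) y : root (map_poly j q) y ->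
    (map_poly j U).[y] = (map_poly j Q).[y]^-1.
  move=> /rootP qy; have := congr1 (fun P => (map_poly j P).[y]) E.
  rewrite rmorphD !rmorphM rmorph1 hornerD !hornerM qy mulr0 addr0 hornerC => UQ.
  have Q0 : (map_poly j Q).[y] != 0.
    by apply: contra_eq_neq UQ => ->; rewrite mulr0 eq_sym oner_neq0.
  by apply: (mulIf Q0); rewrite UQ mulVf.
exists (P * U); rewrite !rmorphM !hornerM !inv //; exact: hom.
Qed.

Lemma poly_graph_gen (K : fieldType) (i sigma : {rmorphism K -> L}) (x w : L) :
  poly_graph i sigma x w (x, w).
Proof. by exists 'X; rewrite !map_polyX !hornerX. Qed.

Lemma poly_graph_base (K : fieldType) (i sigma : {rmorphism K -> L}) (x w : L) c :
  poly_graph i sigma x w (i c, sigma c).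
Proof. by exists c%:P; rewrite !map_polyC !hornerC. Qed.

Section GraphMap.
Variables (R : set (L * L)) (hR : field_graph R).

Lemma field_graph_fun x y y' : R (x, y) -> R (x, y') -> y = y'.
Proof.
move=> Ry Ry'; case: hR => z0 _ /(_ _ _ Ry Ry')[/= + _].
by rewrite subrr => /z0/eqP; rewrite subr_eq0 => /eqP.
Qed.

Lemma field_graphM u v : R u -> R v -> R (u.1 * v.1, u.2 * v.2).
Proof.
case: hR => _ R1 RBD Ru Rv; have [_ Rv'] := RBD _ _ R1 Rv.
by have [_ /=] := RBD _ _ Ru Rv'; rewrite !div1r !invrK.
Qed.

Lemma graph_dom_subfield : is_subfield (fun x => exists y, R (x, y)).
Proof.
case: (hR) => _ R1 RBD; have [R0 _] := RBD _ _ R1 R1.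
split.
- by exists 0; rewrite /= !subrr in R0.
- by exists 1.
- by move=> x y [x' Rx] [y' Ry]; exists (x' - y'); case: (RBD _ _ Rx Ry).
- by move=> x y [x' Rx] [y' Ry]; exists (x' * y'); apply: (field_graphM Rx Ry).
- move=> x [x' Rx]; exists (x'^-1); case: (RBD _ _ R1 Rx) => _ /=.
  by rewrite !div1r.
Qed.

Definition graph_dom : divringClosed L := subfield_pred graph_dom_subfield.

Lemma graph_domP x : reflect (exists y, R (x, y)) (x \in graph_dom).
Proof. exact: subfield_predP. Qed.

Definition graph_map (u : subfld graph_dom) : L :=
  projT1 (cid (elimT (graph_domP _) (valP u))).

Lemma graph_mapP u : R (subfld_val u, graph_map u).
Proof. exact: projT2 (cid (elimT (graph_domP _) (valP u))). Qed.

Lemma graph_map_zmod : zmod_morphism graph_map.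
Proof.
move=> u v; apply: (field_graph_fun (graph_mapP _)); rewrite rmorphB.
by case: hR => _ _ /(_ _ _ (graph_mapP u) (graph_mapP v))[].
Qed.

Lemma graph_map_monoid : monoid_morphism graph_map.
Proof.
split; first by apply: (field_graph_fun (graph_mapP _)); rewrite rmorph1; case: hR.
move=> u v; apply: (field_graph_fun (graph_mapP _)); rewrite rmorphM.
exact: field_graphM (graph_mapP u) (graph_mapP v).
Qed.

HB.instance Definition _ := GRing.isZmodMorphism.Build _ _ graph_map graph_map_zmod.
HB.instance Definition _ := GRing.isMonoidMorphism.Build _ _ graph_map graph_map_monoid.

Definition graph_morphism : {rmorphism subfld graph_dom -> L} := graph_map.
End GraphMap.

Lemma total_graph_morphism R : field_graph R -> (forall x, exists y, R (x, y)) ->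
  exists tau : {rmorphism L -> L}, forall x, R (x, tau x).
Proof.
move=> hR /choice[f Rf].
have fB : zmod_morphism f.
  move=> x y; apply: (field_graph_fun hR (Rf _)).
  by case: hR => _ _ /(_ _ _ (Rf x) (Rf y))[].
have fM : monoid_morphism f.
  split; first by apply: (field_graph_fun hR (Rf _)); case: hR.
  by move=> x y; apply: (field_graph_fun hR (Rf _)); exact: field_graphM (Rf x) (Rf y).
pose fB' := GRing.isZmodMorphism.Build _ _ f fB.
pose fM' := GRing.isMonoidMorphism.Build _ _ f fM.
pose tau : {rmorphism L -> L} := HB.pack f fB' fM'.
by exists tau.
Qed.
End FieldGraph.

Section Extension.
Variables (F L : fieldType) (iota : {rmorphism F -> L}).
Hypothesis sepL : is_sep_closure iota.

Lemma algebraic_over (K : fieldType) (i : {rmorphism K -> L}) x :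
  (forall a, exists c, i c = iota a) ->
  exists f : {poly K}, exists2 f0 : {poly F}, map_poly i f = map_poly iota f0 &
    separable_poly f0 /\ root (map_poly i f) x.
Proof.
move=> /choice[j ij]; case: sepL => /(_ x)[f [sepf fx]] _.
suff [g gE] : exists g, map_poly i g = map_poly iota f by exists g, f; rewrite ?gE.
exists (\poly_(k < size f) j f`_k); apply/polyP => k.
rewrite !coef_map coef_poly; case: ltnP => [_|fk]; first exact: ij.
by rewrite nth_default //; exact: etrans (rmorph0 i) (esym (rmorph0 iota)).
Qed.

(** Let [q] be the minimal polynomial of [x] over the domain. Its image under [sigma] divides a
    separable polynomial coming from [F], so it has a root [w] in [L]; the graph extended by
    [(x, w)] lies in [R] by maximality. *)
Lemma maximal_graph_total (R : set (L * L)) : field_graph R ->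
  (forall a, R (iota a, iota a)) ->
  (forall R', field_graph R' -> (R `<=` R')%classic -> (R' `<=` R)%classic) ->
  forall x, exists y, R (x, y).
Proof.
move=> hR Riota Rmax x; pose K := graph_dom hR; pose i := subfld_val (S := K).
pose sigma := graph_morphism hR.
have iotaK a : exists c : subfld K, i c = iota a.
  by apply: subfld_lift; apply/graph_domP; exists (iota a).
have [f [f0 fE [sepf fx]]] := algebraic_over x iotaK.
have sep0 : f0 != 0 := separable_poly_neq0 sepf.
have f_neq0 : f != 0 by rewrite -(map_poly_eq0 i) fE map_poly_eq0.
have [q [q0 qx qmin]] := exists_minimal_poly (ex_intro _ f (conj f_neq0 fx)).
have fsE : map_poly sigma f = map_poly iota f0.
  apply/polyP => k; rewrite !coef_map; apply: (field_graph_fun hR (graph_mapP (hR := hR) f`_k)).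
  have E : (map_poly i f)`_k = (map_poly iota f0)`_k by rewrite fE.
  rewrite !coef_map in E; rewrite (E : subfld_val _ = _); exact: Riota.
have [w qw] : exists w, root (map_poly sigma q) w.
  apply: (proj2 sepL); last first.
    rewrite size_map_poly -(size_map_poly i); apply: (@root_size_gt1 _ x) => //.
    by rewrite map_poly_eq0.
  apply: (@dvdp_separable _ (map_poly sigma f)); first by rewrite dvdp_map qmin.
  by rewrite fsE separable_map.
exists w; apply: (Rmax (poly_graph i sigma x w)).
- apply: poly_graph_field; first by exists q.
  by move=> P /qmin /dvdpP[Q ->]; rewrite rmorphM rootM qw orbT.
- move=> [a b] Rab; have [c cE] : exists c : subfld K, i c = a.
    by apply: subfld_lift; apply/graph_domP; exists b.
  have <- : sigma c = b by apply: (field_graph_fun hR (graph_mapP (hR := hR) c)); rewrite -[subfld_val c]/(i c) cE.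
  by rewrite -cE; apply: poly_graph_base.
- exact: poly_graph_gen.
Qed.

Lemma graph_extends (R0 : set (L * L)) : field_graph R0 -> (forall a, R0 (iota a, iota a)) ->
  exists tau : {rmorphism L -> L}, forall u, R0 u -> tau u.1 = u.2.
Proof.
move=> hR0 R0iota.
pose P : set (set (L * L)) := fun R => R = set0 \/ field_graph R /\ (R0 `<=` R)%classic.
have chainP (C : set (set (L * L))) : (C `<=` P)%classic -> total_on C subset ->
    P (\bigcup_(X in C) X)%classic.
  move=> CP Ctot; case: (pselect (exists2 X, C X & X !=set0)%classic) => [[X CX [u Xu]]|none].
    right; have X0 : (R0 `<=` X)%classic by case: (CP X CX) => [X0|[]//]; rewrite X0 in Xu.
    have inC Y v : C Y -> Y v -> field_graph Y.
      by move=> CY Yv; case: (CP Y CY) => [Y0|[]//]; rewrite Y0 in Yv.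
    split; last by move=> v /X0 Xv; exists X.
    split.
    - by move=> y [Y CY Yy]; case: (inC _ _ CY Yy) => + _ _; apply.
    - by exists X => //; case: (inC _ _ CX Xu).
    move=> v w [Y CY Yv] [Z CZ Zw]; case: (Ctot _ _ CY CZ) => [YZ|ZY].
      case: (inC _ _ CZ Zw) => _ _ /(_ v w (YZ _ Yv) Zw)[? ?].
      by split; exists Z.
    case: (inC _ _ CY Yv) => _ _ /(_ v w Yv (ZY _ Zw))[? ?].
    by split; exists Y.
  left; apply/seteqP; split=> // u [X CX Xu]; apply: none; exists X => //; by exists u.
have [R [PR Rmax]] := Zorn_bigcup chainP.
have [hR R0R] : field_graph R /\ (R0 `<=` R)%classic.
  case: PR => // R_0; case: (Rmax R0); last (right; split; [exact: hR0|by []]).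
  rewrite R_0 properEneq; split=> //; apply/eqP => E; case: hR0 => _ R01 _; by rewrite -E in R01.
have [|tau tauR] := total_graph_morphism hR.
  apply: maximal_graph_total => // [a|R' hR' RR']; first exact/R0R/R0iota.
  apply: contrapT => R'R; apply: (Rmax R'); first by split.
  by right; split=> //; apply: subset_trans RR'.
exists tau => -[x y] /R0R Rxy /=; exact: (field_graph_fun hR (tauR x) Rxy).
Qed.

(** The hypothesis [hom] says that [w] is a conjugate of [x] over [S]. The extension reaches all of
    [L], so that later Galois arguments only handle endomorphisms of [L]. *)
Lemma extend_morphism (S : divringClosed L) x w : (forall a, iota a \in S) ->
  (forall P : {poly L}, P \is a polyOver S -> root P x -> root P w) ->
  exists tau : {rmorphism L -> L}, {in S, forall y, tau y = y} /\ tau x = w.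
Proof.
move=> Siota hom; pose i := subfld_val (S := S).
have iotaS a : exists c : subfld S, i c = iota a by apply: subfld_lift.
have [f [f0 fE [sepf fx]]] := algebraic_over x iotaS.
have sep0 : f0 != 0 := separable_poly_neq0 sepf.
have f_neq0 : f != 0 by rewrite -(map_poly_eq0 i) fE map_poly_eq0.
have [||tau tauP] := @graph_extends (poly_graph i i x w).
- apply: poly_graph_field; first by exists f.
  by move=> P; apply: hom; apply: map_subfld_over.
- by move=> a; have [c <-] := iotaS a; apply: poly_graph_base.
exists tau; split; last exact: (tauP _ (poly_graph_gen _ _ _ _)).
move=> y /subfld_lift[c <-]; exact: (tauP _ (poly_graph_base _ _ _ _ c)).
Qed.
End Extension.

(** * Kummer theory *)

Section Generated.
Variable L : fieldType.
Implicit Types (A : L -> Prop) (S T : divringClosed L).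

Lemma gen_subfield A : is_subfield (gen A).
Proof.
split.
- by move=> S [].
- by move=> S [].
- move=> x y Sx Sy S hS AS; case: (hS) => _ _ SB _ _; apply: SB; [exact: Sx | exact: Sy].
- move=> x y Sx Sy S hS AS; case: (hS) => _ _ _ SM _; apply: SM; [exact: Sx | exact: Sy].
- move=> x Sx S hS AS; case: (hS) => _ _ _ _; apply; exact: Sx.
Qed.

Definition generated A : divringClosed L := subfield_pred (gen_subfield A).

Lemma generatedP A x : reflect (gen A x) (x \in generated A).
Proof. exact: subfield_predP. Qed.

Lemma generated_gen A x : A x -> x \in generated A.
Proof. by move=> Ax; apply/generatedP => S _; apply. Qed.

Lemma generated_sub A T : (forall x, A x -> x \in T) -> {subset generated A <= T}.
Proof. by move=> AT x /generatedP/(_ _ (divring_is_subfield T)); apply. Qed.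

Lemma generated_morphism A T (g : {rmorphism L -> L}) :
  (forall x, A x -> g x \in T) -> {in generated A, forall x, g x \in T}.
Proof.
move=> AT x /generatedP/(_ (fun x => g x \in T)); apply; last exact: AT.
split=> [|||u v|u]; rewrite ?rmorph0 ?rmorph1 ?rpred0 ?rpred1 //.
- by move=> u v Su Sv; rewrite rmorphB rpredB.
- by move=> Su Sv; rewrite rmorphM rpredM.
- by move=> Su; rewrite fmorphV rpredV.
Qed.

Lemma generated_eq A (g h : {rmorphism L -> L}) :
  (forall x, A x -> g x = h x) -> {in generated A, forall x, g x = h x}.
Proof.
move=> AT x /generatedP/(_ (fun x => g x = h x)); apply; last exact: AT.
split=> [|||u v|u]; rewrite ?rmorph0 ?rmorph1 //.
- by move=> u v Su Sv; rewrite !rmorphB Su Sv.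
- by move=> Su Sv; rewrite !rmorphM Su Sv.
- by move=> Su; rewrite !fmorphV Su.
Qed.

Definition adjoin S x : divringClosed L := generated (fun y => y \in S \/ y = x).

Lemma adjoin_sub S x : {subset S <= adjoin S x}.
Proof. by move=> y Sy; apply: generated_gen; left. Qed.
Lemma adjoin_gen S x : x \in adjoin S x.
Proof. by apply: generated_gen; right. Qed.
Lemma adjoin_least S T x : {subset S <= T} -> x \in T -> {subset adjoin S x <= T}.
Proof. by move=> ST Tx; apply: generated_sub => y [/ST | ->]. Qed.
Lemma adjoinS S T x : {subset S <= T} -> {subset adjoin S x <= adjoin T x}.
Proof.
by move=> ST; apply: adjoin_least (adjoin_gen _ _) => y /ST; apply: adjoin_sub.
Qed.
Lemma adjoin_id S x : x \in S -> adjoin S x =i S.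
Proof. by move=> Sx y; apply/idP/idP; [apply: adjoin_least | apply: adjoin_sub]. Qed.
End Generated.

(** Hides the concrete subfield type behind an abstract field and its embedding. *)
Lemma subfield_model (L : fieldType) (S : divringClosed L) :
  exists (K : fieldType) (i : {rmorphism K -> L}),
    [/\ forall c, i c \in S, forall x, x \in S -> exists c, i c = x,
        forall P, map_poly i P \is a polyOver S &
        forall P : {poly L}, P \is a polyOver S -> exists Q, map_poly i Q = P].
Proof.
exists (subfld S), subfld_val; split=> [c|x|P|P]; first exact: subfld_valP.
- exact: subfld_lift.
- exact: map_subfld_over.
- exact: polyOver_lift.
Qed.

Section Kummer.
Variables (F L : fieldType) (iota : {rmorphism F -> L}) (p : nat) (z : L).
Hypotheses (sepL : is_sep_closure iota) (pp : prime p) (zP : p.-primitive_root z).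
Let p0 : (0 < p)%N := prime_gt0 pp.
Let z0 : z != 0. Proof. by rewrite (prim_root_eq0 zP) -lt0n. Qed.
Implicit Types S : divringClosed L.

Lemma pow_in_of_coprime S x n : ~~ (p %| n)%N ->
  x ^+ n \in S -> x ^+ p \in S -> x \in S.
Proof.
move=> pn Sxn Sxp; have [-> | x0] := eqVneq x 0; first exact: rpred0.
have n0 : (0 < n)%N by rewrite lt0n; apply: contraNneq pn => ->; rewrite dvdn0.
case: (egcdnP p n0) => u v E _.
have g1 : gcdn n p = 1%N by rewrite gcdnC; apply/eqP; rewrite -/(coprime p n) prime_coprime.
have -> : x = (x ^+ n) ^+ u / (x ^+ p) ^+ v.
  apply: (mulIf (expf_neq0 v (expf_neq0 p x0))); rewrite divfK ?expf_neq0 //.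
  by rewrite -!exprM (mulnC n) E g1 (mulnC p) exprD expr1 mulrC.
by rewrite rpredM ?rpredV ?(rpredX _ Sxn) ?(rpredX _ Sxp).
Qed.

Lemma XnsubC_factor x : x != 0 ->
  'X^p - (x ^+ p)%:P = \prod_(y <- mkseq (fun i => z ^+ i * x) p) ('X - y%:P).
Proof.
move=> x0; rewrite [LHS](all_roots_prod_XsubC (rs := mkseq (fun i => z ^+ i * x) p)).
- by rewrite lead_coefXnsubC // scale1r.
- by rewrite size_XnsubC // size_mkseq.
- apply/allP => _ /mapP[i _ ->]; rewrite rootE !hornerE.
  by rewrite exprMn exprAC (prim_expr_order zP) expr1n mul1r subrr.
rewrite uniq_rootsE; apply/mkseq_uniqP => i j; rewrite !inE => ip jp /(mulIf x0)/eqP.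
by rewrite (eq_prim_root_expr zP) !modn_small // => /eqP.
Qed.

(** The minimal polynomial of [x] over [S] divides [X^p - x^p], hence is a product over a set [s] of
    conjugates [z^i x]. Its constant term puts [x ^+ size s] in [S]; as [x] is not in [S], [p]
    divides [size s], so that [s] contains every conjugate. *)
Lemma kummer_irreducible S x (P : {poly L}) : z \in S -> x \notin S -> x ^+ p \in S ->
  P \is a polyOver S -> root P x -> root P (z * x).
Proof.
move=> Sz Sx Sxp SP Px; have [K [i [iS liftS _ liftP]]] := subfield_model S.
have x0 : x != 0 by apply: contraNneq Sx => ->; apply: rpred0.
have [a aE] := liftS _ Sxp; pose E := 'X^p - a%:P : {poly K}.
have EE : map_poly i E = 'X^p - (x ^+ p)%:P.
  by rewrite rmorphB /= map_polyXn map_polyC /= aE.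
have Ex : root (map_poly i E) x by rewrite EE rootE !hornerE subrr.
have E0 : E != 0 by rewrite -size_poly_gt0 size_XnsubC.
have [q [q0 qx qmin]] := exists_minimal_poly (ex_intro _ E (conj E0 Ex)).
have [Q QE] := liftP _ SP.
have /dvdpP[Q1 Q1E] : q %| Q by apply: qmin; rewrite QE.
suff : root (map_poly i q) (z * x) by rewrite -QE Q1E rmorphM rootM orbC => ->.
have : map_poly i q %| map_poly i E by rewrite dvdp_map qmin.
rewrite EE XnsubC_factor //; set rs := mkseq _ p => /dvdp_prod_XsubC[m].
set s := mask m rs => /eqpP[[c1 c2] /= /andP[c10 c20] qs].
have s_rs : {subset s <= rs} by move=> y; rewrite /s => /mem_mask.
have qE : map_poly i q = lead_coef (map_poly i q) *: \prod_(y <- s) ('X - y%:P).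
  have : lead_coef (c1 *: map_poly i q) = c2.
    by rewrite qs lead_coefZ (monicP (monic_prod_XsubC _ _ _)) mulr1.
  rewrite lead_coefZ => lE; apply: (scalerI c10); rewrite scalerA lE; exact: qs.
have [u [Su u0 uE]] : exists u, [/\ u \in S, u != 0 & \prod_(y <- s) (0 - y) = u * x ^+ size s].
  elim: (s) s_rs => [_|y s' IH sub]; first by exists 1; rewrite rpred1 oner_neq0 big_nil mul1r.
  have [|u [Su u0 uE]] := IH; first by move=> v vs; apply: sub; rewrite inE vs orbT.
  have /mapP[j _ ->] := sub y (mem_head _ _).
  exists (- z ^+ j * u); split.
  - by rewrite rpredM ?rpredN ?rpredX.
  - by rewrite mulf_neq0 ?oppr_eq0 ?expf_neq0.
  by rewrite big_cons uE sub0r exprS; ring.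
have lq0 : lead_coef (map_poly i q) != 0 by rewrite lead_coef_eq0 map_poly_eq0.
have Sxs : x ^+ size s \in S.
  have := congr1 (fun P => P.[0]) qE; rewrite hornerZ horner_prod.
  under [X in _ = _ * X]eq_bigr => y _ do rewrite !hornerE.
  under eq_bigr => y _ do rewrite -[- y]add0r.
  rewrite uE => E1.
  have -> : x ^+ size s = (map_poly i q).[0] / (lead_coef (map_poly i q) * u).
    by rewrite E1 mulrA mulrC mulKf ?mulf_neq0.
  rewrite rpredM ?rpredV ?rpredM //; first by rewrite horner_coef0 coef_map; apply: iS.
  by rewrite lead_coef_map; apply: iS.
have ps : (p %| size s)%N by apply: contraNT Sx => ps; apply: pow_in_of_coprime ps Sxs Sxp.
have s_neq : size s != 0%N.
  apply: contraTneq qx => /size0nil s0; rewrite qE s0 big_nil.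
  by rewrite rootE hornerZ hornerC mulr1.
have szs : size rs = p by rewrite size_mkseq.
have size_s : size s = size rs.
  apply/eqP; rewrite eqn_leq size_subseq ?mask_subseq //= szs.
  by apply: dvdn_leq ps; rewrite lt0n.
have -> : map_poly i q = lead_coef (map_poly i q) *: \prod_(y <- rs) ('X - y%:P).
  rewrite {1}qE; congr (_ *: _); congr (\prod_(y <- _) _).
  have [_ sE] := size_subseq_leqif (mask_subseq m rs).
  by apply/eqP; rewrite -sE -/s size_s.
rewrite rootZ // -XnsubC_factor // rootE !hornerE exprMn (prim_expr_order zP).
by rewrite mul1r subrr.
Qed.

Lemma kummer_conjugation S x : (forall a, iota a \in S) -> z \in S -> x \notin S -> x ^+ p \in S ->
  exists g : {rmorphism L -> L}, {in S, forall y, g y = y} /\ g x = z * x.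
Proof.
move=> Siota Sz Sx Sxp; apply: (extend_morphism sepL Siota) => P SP.
exact: kummer_irreducible Sz Sx Sxp SP.
Qed.

(** The values at [x] of polynomials over [S] form a field, namely the domain of a [poly_graph]. *)
Lemma adjoin_poly S x y : x ^+ p \in S -> y \in adjoin S x ->
  exists P : {poly L}, P \is a polyOver S /\ y = P.[x].
Proof.
move=> Sxp; have [K [i [iS liftS overS _]]] := subfield_model S.
have [a aE] := liftS _ Sxp; pose E := 'X^p - a%:P : {poly K}.
have Ex : root (map_poly i E) x.
  by rewrite rmorphB /= map_polyXn map_polyC /= aE rootE !hornerE subrr.
have E0 : E != 0 by rewrite -size_poly_gt0 size_XnsubC.
have hR := poly_graph_field (ex_intro _ E (conj E0 Ex)) (fun P Px => Px : root (map_poly i P) x).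
suff : {subset adjoin S x <= graph_dom hR}.
  move=> sub /sub /graph_domP[w [P [-> _]]]; exists (map_poly i P); split=> //; exact: overS.
apply: adjoin_least; last by apply/graph_domP; exists x; apply: poly_graph_gen.
move=> u /liftS[c <-]; apply/graph_domP; exists (i c); exact: poly_graph_base.
Qed.

(** Averaging [y] over the iterates of [g] kills the terms in [x ^+ i] with [i] prime to [p]; the
    others are polynomial in [x ^+ p]. *)
Lemma adjoin_fixed S x (g : {rmorphism L -> L}) y : z \in S -> x ^+ p \in S ->
  {in S, forall y, g y = y} -> g x = z * x -> y \in adjoin S x -> g y = y -> y \in S.
Proof.
move=> Sz Sxp gS gx /(adjoin_poly Sxp)[P [/polyOverP SP ->]] gy.
have gz := gS z Sz.
have gP j : rpow g j P.[x] = \sum_(i < size P) P`_i * x ^+ i * z ^+ (i * j).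
  rewrite horner_coef rmorph_sum; apply: eq_bigr => i _.
  rewrite rmorphM rmorphXn (rpow_fix _ (gS _ (SP i))) (rpow_eigen _ gz gx).
  by rewrite exprMn -exprM mulnC -mulrA [z ^+ _ * _]mulrC.
have : \sum_(j < p) rpow g j P.[x] = p%:R * P.[x].
  under eq_bigr => j _ do rewrite rpow_fix //.
  by rewrite sumr_const card_ord mulr_natl.
under eq_bigr => j _ do rewrite gP.
rewrite exchange_big /=; under eq_bigr => i _ do rewrite -mulr_sumr (sum_prim_expr zP).
have pn0 := prim_root_natf_neq0 zP.
move=> /(canLR (mulKf pn0)) <-; rewrite rpredM ?rpredV ?rpredMn ?rpred1 //.
apply: rpred_sum => i _; case: ifP => [/dvdnP[k ->] | _]; last by rewrite mulr0 rpred0.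
by rewrite !rpredM // ?rpredMn ?rpred1 // mulnC exprM rpredX.
Qed.

(** A conjugation [g] with [g x = z * x] multiplies [y] by some [z ^+ k], so it fixes
    [y / x ^+ k]. *)
Lemma kummer_root S x y : (forall a, iota a \in S) -> z \in S -> x ^+ p \in S -> x != 0 ->
  y \in adjoin S x -> y ^+ p \in S -> y != 0 -> exists k d, [/\ d \in S, d != 0 & y = x ^+ k * d].
Proof.
move=> Siota Sz Sxp x0 Sy Syp y0; have [Sx | Sx] := boolP (x \in S).
  by exists 0%N, y; rewrite mul1r -(adjoin_id Sx).
have [g [gS gx]] := kummer_conjugation Siota Sz Sx Sxp.
have : (g y / y) ^+ p = 1 by rewrite expr_div_n -rmorphXn gS // divff // expf_neq0.
move=> /(prim_rootP zP)[k /(canRL (divfK y0)) gy].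
exists k, (y / x ^+ k); split; last by rewrite mulrC divfK ?expf_neq0.
  apply: (adjoin_fixed Sz Sxp gS gx).
    by rewrite rpredM ?rpredV ?rpredX ?adjoin_gen.
  by rewrite fmorph_div rmorphXn gx gy exprMn -mulf_div divff ?mul1r ?expf_neq0.
by rewrite mulf_neq0 ?invr_eq0 ?expf_neq0.
Qed.

Lemma root_exists c : c != 0 -> exists y : L, y ^+ p = c.
Proof.
move=> c0; have pn0 := prim_root_natf_neq0 zP.
have [||y] := proj2 sepL ('X^p - c%:P).
- rewrite unlock derivB derivXn derivC subr0.
  (* With [P = X^p - c], the identity is [p^-1 X P' - P = c]. *)
  apply/Bezout_coprimepP; exists (- 1, (p%:R)^-1 *: 'X) => /=.
  rewrite -scalerAl mulrnAr -exprS prednK // -scaler_nat scalerA mulVf // scale1r.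
  rewrite mulN1r opprB addrNK.
  by rewrite -size_poly_eq1 size_polyC c0.
- by rewrite size_XnsubC // ltnS.
by rewrite rootE !hornerE subr_eq0 => /eqP yc; exists y.
Qed.
End Kummer.

(** * Propagation of rigidity along Kummer towers *)

Section Rigidity.
Variables (F L : fieldType) (iota : {rmorphism F -> L}) (p : nat) (z : L).
Hypotheses (sepL : is_sep_closure iota) (pp : prime p) (op : odd p).
Hypotheses (zP : p.-primitive_root z) (Fz : exists a, z = iota a).
Let p0 : (0 < p)%N := prime_gt0 pp.
Let z0 : z != 0. Proof. by rewrite (prim_root_eq0 zP) -lt0n. Qed.
Implicit Types (S T : divringClosed L) (x y : L).

Definition contains_base S := forall a, iota a \in S.

Lemma base_z S : contains_base S -> z \in S.
Proof. by case: Fz => a -> ; apply. Qed.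

(** The product over [s] is the norm of the sum from [S(theta)] when [theta] is not in [S]; writing
    out the conjugates avoids choosing an automorphism. *)
Definition rigid_in S (b : L) := forall theta (c : nat -> L), theta ^+ p = b ->
  (forall i, c i \in S) -> \sum_(i < p) c i * theta ^+ i != 0 -> exists k d,
  [/\ d \in S, d != 0 &
    \prod_(s < p) (\sum_(i < p) c i * (z ^+ s * theta) ^+ i) = b ^+ k * d ^+ p].

Definition base_rigid S := forall f : F, f != 0 ->
  ~ (exists y, y \in S /\ y ^+ p = iota f) -> rigid_in S (iota f).

Lemma pnorm_expansion (t : {rmorphism L -> L}) theta (c : nat -> L) :
  t z = z -> t theta = z * theta -> (forall i, t (c i) = c i) ->
  pnorm t p (\sum_(i < p) c i * theta ^+ i) =
  \prod_(s < p) (\sum_(i < p) c i * (z ^+ s * theta) ^+ i).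
Proof.
move=> tz tth tc; apply: eq_bigr => s _; rewrite rmorph_sum; apply: eq_bigr => i _.
by rewrite rmorphM rmorphXn (rpow_eigen _ tz tth) rpow_fix.
Qed.

Lemma prim_neq1 : z != 1.
Proof.
have := prim_order_dvd zP 1; rewrite expr1 dvdn1 => <-.
by rewrite neq_ltn prime_gt1 ?orbT.
Qed.

(** Elements fixed by [s] expand in powers of [theta] with coefficients in [S], and [iota b] is not
    a [p]-th power in [S] because [t] moves [theta] and fixes [S]. *)
Lemma rigid_lineP S (M : divringClosed L) (g h s t : {rmorphism L -> L}) theta b :
  contains_base S -> base_rigid S -> {subset S <= M} ->
  {in S, forall y, [/\ g y = y, h y = y & t y = y]} ->
  {in M, forall y, s y = y -> t y = y -> y \in S} ->
  {in M, forall y, t y \in M} -> {in M, forall y, rpow t p y = y} ->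
  {in M, forall y, s (t y) = t (s y)} ->
  theta \in M -> theta != 0 -> s theta = theta -> t theta = z * theta ->
  theta ^+ p = iota b -> rigid_line p M g h s t theta.
Proof.
move=> FS rS SM fixS fixM tM tp st Mth th0 sth tth thb x Mx x0 sx.
have tz : t z = z by case: (fixS z (base_z FS)).
pose D : divringClosed L := fixed_in M s.
have DP y : reflect (y \in M /\ s y = y) (y \in D) by apply: fixed_inP.
have tD : {in D, forall y, t y \in D}.
  by move=> y /DP[My sy]; apply/DP; rewrite tM // st // sy.
have tpD : {in D, forall y, rpow t p y = y} by move=> y /DP[My _]; rewrite tp.
have Dth : theta \in D by apply/DP.
have Dx : x \in D by apply/DP.
have [e [De xE]] := fixed_expansion zP tz tD tpD Dth th0 tth Dx.
have Se i : e i \in S by have [/DP[Me se] te] := De i; apply: fixM.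
have b0 : b != 0 by rewrite -(fmorph_eq0 iota) -thb expf_neq0.
have nb : ~ exists y, y \in S /\ y ^+ p = iota b.
  move=> [y [Sy yb]]; have y0 : y != 0.
    by apply: contraNneq b0 => y0; rewrite -(fmorph_eq0 iota) -yb y0 expr0n gtn_eqF.
  have : (theta / y) ^+ p = 1 by rewrite expr_div_n thb yb divff // fmorph_eq0.
  move=> /(prim_rootP zP)[j /(canRL (divfK y0)) thE].
  have [_ _ ty] := fixS y Sy.
  have : t theta = theta by rewrite thE rmorphM rmorphXn tz ty.
  rewrite tth -[X in _ = X]mul1r => /(mulIf th0)/eqP; exact/negP/prim_neq1.
have [|k [d [Sd d0 E]]] := rS b b0 nb theta e thb Se; first by rewrite -xE.
exists k, d; have [gd hd _] := fixS d Sd.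
split; first by split=> //; apply: SM.
by rewrite xE pnorm_expansion ?thb // => i; case: (De i).
Qed.

Section Step.
Variables (S : divringClosed L) (al : L) (a : F).
Hypotheses (FS : contains_base S) (rS : base_rigid S).
Hypotheses (a0 : a != 0) (ala : al ^+ p = iota a) (Sal : al \notin S).
Let D := adjoin S al.
Let Sz : z \in S := base_z FS.
Let Salp : al ^+ p \in S. Proof. by rewrite ala. Qed.
Let al0 : al != 0. Proof. by apply: contraNneq Sal => ->; apply: rpred0. Qed.
Let SD : {subset S <= D} := @adjoin_sub _ S al.
Let Dal : al \in D := adjoin_gen S al.

Lemma adjoin_conj (T : divringClosed L) x (g : {rmorphism L -> L}) :
  contains_base T -> {in T, forall y, g y = y} -> g x = z * x ->
  {in adjoin T x, forall y, g y \in adjoin T x} /\ {in adjoin T x, forall y, rpow g p y = y}.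
Proof.
move=> FT gT gx; have Tz := base_z FT; split.
  apply: generated_morphism => y [Ty | ->]; first by rewrite gT // adjoin_sub.
  by rewrite gx rpredM ?adjoin_gen // adjoin_sub.
apply: (generated_eq (h := idfun)) => y [Ty | ->]; first by rewrite rpow_fix ?gT.
by rewrite (rpow_eigen _ (gT z Tz) gx) (prim_expr_order zP) mul1r.
Qed.

(** With the identity for [s], [rigid_line] speaks of all of [D], which is the hypothesis on norms
    in [norm_group_decomposition] for the cyclic extension [D] of [S]. *)
Lemma adjoin_decomposition x : x \in D -> x != 0 -> exists k c d,
  [/\ c \in S, d \in D, d != 0 & x = al ^+ k * c * d ^+ p].
Proof.
have [g [gS gal]] := kummer_conjugation sepL pp zP FS Sz Sal Salp.
have [gD gp] := adjoin_conj FS gS gal.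
have fixD y : y \in D -> g y = y -> y \in S := @adjoin_fixed _ p z pp zP S al g y Sz Salp gS gal.
have line : rigid_line p D g g idfun g al.
  apply: (rigid_lineP FS rS (b := a)) => //.
  - by move=> y Sy; rewrite gS.
  - by move=> y Dy _; apply: fixD.
have normD u : u \in D -> u != 0 -> exists k d,
  [/\ d \in D, d != 0, g d = d & pnorm g p u = (al ^+ p) ^+ k * d ^+ p].
  by move=> Du u0; have [k [d [[? ? ? _] E]]] := line u Du u0 erefl; exists k, d.
move=> Dx x0.
have [k [c [d [[Dc gc Dd d0] xE]]]] :=
  norm_group_decomposition pp op zP (gS z Sz) gD gp Dal al0 gal normD Dx x0.
by exists k, c, d; split=> //; apply: fixD.
Qed.

(** Adjoining a root [ph] of [iota f] to [D] gives a bicyclic extension of [S]. All its lines are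
    generated by [p]-th roots of elements [a / f^m] or [f / a^m] of [F], where rigidity over [S]
    applies, and [bicyclic_norm] concludes. *)
Lemma base_rigid_adjoin : base_rigid D.
Proof.
move=> f f0 nf ph c phf Dc x0.
have FD : contains_base D by move=> b; apply: SD.
have ph0 : ph != 0 by apply: contraNneq f0 => ph0; rewrite -(fmorph_eq0 iota) -phf ph0 expr0n gtn_eqF.
have Dph : ph \notin D by apply/negP => Dph; apply: nf; exists ph.
have Dphp : ph ^+ p \in D by rewrite phf FD.
have Sphp : ph ^+ p \in S by rewrite phf.
have [h [hD hph]] := kummer_conjugation sepL pp zP FD (base_z FD) Dph Dphp.
pose S' := adjoin S ph.
have FS' : contains_base S' by move=> b; apply: adjoin_sub.
(* Otherwise [al = ph^k d] with [d] in [S]: either [p] divides [k] and [al] is in [S], or [ph] is in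
   [D]. *)
have S'al : al \notin S'.
  apply/negP => /(kummer_root sepL pp zP FS Sz Sphp ph0)/(_ Salp al0)[k [d [Sd d0 alE]]].
  have [pk | pk] := boolP (p %| k)%N.
    case/negP: Sal; rewrite alE; case/dvdnP: pk => q ->.
    by rewrite mulnC exprM rpredM // rpredX.
  case/negP: Dph; apply: (pow_in_of_coprime pp pk) => //.
  have -> : ph ^+ k = al / d by rewrite alE mulfK.
  by rewrite rpredM ?rpredV // SD.
have S'alp : al ^+ p \in S' by rewrite ala FS'.
have [g [gS' gal]] := kummer_conjugation sepL pp zP FS' (base_z FS') S'al S'alp.
have gS : {in S, forall y, g y = y} by move=> y Sy; rewrite gS' // adjoin_sub.
have gph : g ph = ph by rewrite gS' // adjoin_gen.
have hS : {in S, forall y, h y = y} by move=> y Sy; rewrite hD // SD.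
have [gD gpD] := adjoin_conj FS gS gal.
pose M := adjoin D ph.
have DM : {subset D <= M} := @adjoin_sub _ D ph.
have Mph : ph \in M := adjoin_gen D ph.
have [hM hp] := adjoin_conj FD hD hph.
have gM : {in M, forall y, g y \in M}.
  by apply: generated_morphism => y [Dy | ->]; [apply/DM/gD | rewrite gph].
have gp : {in M, forall y, rpow g p y = y}.
  apply: (generated_eq (h := idfun)) => y [Dy | ->]; first exact: gpD.
  by rewrite rpow_fix.
have gh : {in M, forall y, g (h y) = h (g y)}.
  apply: (generated_eq (g := g \o h) (h := h \o g)) => y [Dy | ->] /=.
    by rewrite hD // hD // gD.
  by rewrite hph rmorphM gph hph (gS z).
have fixM y : y \in M -> g y = y -> h y = y -> y \in S.
  move=> My gy hy; apply: (adjoin_fixed pp zP Sz Salp gS gal) => //.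
  exact: (adjoin_fixed pp zP (base_z FD) Dphp hD hph).
have SM : {subset S <= M} by move=> y /SD/DM.
have Mal : al \in M := DM _ Dal.
have hal : h al = al by rewrite hD.
have gz : g z = z by apply: gS.
have hz : h z = z by apply: hS.
have B : bicyclic p z M g h al ph.
  split=> // m.
    apply: (rigid_lineP FS rS (b := a / f ^+ m)) => //.
    - by move=> y Sy; rewrite gS // hS.
    - move=> y My /= + gy; rewrite (rpow_comm m 1 gM hM gh My : rpow g m (h y) = _) => sy.
      by apply: fixM => //; move: sy; rewrite /= rpow_fix.
    - by move=> y My; rewrite /= -gh // -rpowSr.
    - by rewrite rpredM ?rpredV ?(rpredX _ Mph).
    - by rewrite mulf_neq0 ?invr_eq0 ?expf_neq0.
    - rewrite /= fmorph_div rmorphXn hal hph exprMn fmorph_div (rpow_eigen _ gz gal).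
      rewrite rmorphM !rmorphXn /= (rpow_fix _ gz) (rpow_fix _ gph).
      by rewrite -mulf_div divff ?mul1r ?expf_neq0.
    - by rewrite fmorph_div gal rmorphXn gph mulrA.
    - by rewrite expr_div_n exprAC ala phf fmorph_div rmorphXn.
  apply: (rigid_lineP FS rS (b := f / a ^+ m)) => //.
  - by move=> y Sy; rewrite gS // hS.
  - move=> y My /= + hy; rewrite -(rpow_comm 1 m gM hM gh My : g (rpow h m y) = _) => sy.
    by apply: fixM => //; move: sy; rewrite /= rpow_fix.
  - by move=> y My; rewrite /= gh // -rpowSr.
  - by rewrite rpredM ?rpredV ?(rpredX _ Mal).
  - by rewrite mulf_neq0 ?invr_eq0 ?expf_neq0.
  - rewrite /= fmorph_div rmorphXn gal gph exprMn fmorph_div (rpow_eigen _ hz hph).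
    rewrite rmorphM !rmorphXn /= (rpow_fix _ hz) (rpow_fix _ hal).
    by rewrite -mulf_div divff ?mul1r ?expf_neq0.
  - by rewrite fmorph_div hph rmorphXn hal mulrA.
  - by rewrite expr_div_n exprAC ala phf fmorph_div rmorphXn.
have [||k [d [Md d0 hd E]]] := bicyclic_norm pp op zP B (x := \sum_(i < p) c i * ph ^+ i) => //.
  by apply: rpred_sum => i _; rewrite rpredM ?(rpredX _ Mph) // DM.
exists k, d; split=> //; first exact: (adjoin_fixed pp zP (base_z FD) Dphp hD hph).
by rewrite -phf -E pnorm_expansion // => i; rewrite hD.
Qed.
End Step.

(** * Finite Kummer towers *)

Definition kummer_elt x := exists f : F, f != 0 /\ x ^+ p = iota f.

Definition adjoins S (l : seq L) : divringClosed L := foldr (fun x T => adjoin T x) S l.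

Lemma adjoins_sub S l : {subset S <= adjoins S l}.
Proof. by elim: l => // x l IH y /IH; apply: adjoin_sub. Qed.

Lemma adjoinsS S T l : {subset S <= T} -> {subset adjoins S l <= adjoins T l}.
Proof. by elim: l => // x l IH ST; apply: adjoinS; apply: IH. Qed.

Lemma base_rigid_ext S T : S =i T -> base_rigid S -> base_rigid T.
Proof.
move=> ST rS f f0 nf theta c thf Tc x0.
have [||k [d [Sd d0 E]]] := rS f f0 _ theta c thf _ x0.
- by move=> [y [Sy yf]]; apply: nf; exists y; rewrite -ST.
- by move=> i; rewrite ST.
by exists k, d; rewrite -ST.
Qed.

(** [p]-th roots of elements of [F] are closed under products, so the powers of the generators split
    off at the successive steps combine into a single [b]. *)
Lemma tower_decomposition S l : contains_base S -> base_rigid S ->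
  (forall x, x \in S -> x != 0 -> exists b d, [/\ kummer_elt b, d \in S, d != 0 & x = b * d ^+ p]) ->
  {in l, forall x, kummer_elt x} -> base_rigid (adjoins S l) /\
  (forall x, x \in adjoins S l -> x != 0 ->
    exists b d, [/\ kummer_elt b, d \in adjoins S l, d != 0 & x = b * d ^+ p]).
Proof.
move=> FS rS decS; elim: l => [|x l IH] kl; first by [].
have [|rT decT] := IH; first by move=> y yl; apply: kl; rewrite inE yl orbT.
have FT : contains_base (adjoins S l) by move=> b; apply: adjoins_sub.
have [f [f0 xf]] := kl x (mem_head _ _).
have [Tx | Tx] := boolP (x \in adjoins S l).
  have TE := adjoin_id Tx; split.
    by apply: base_rigid_ext rT => y; rewrite /= TE.
  move=> y; rewrite /= TE => Ty y0; have [b [d [kb Td d0 yE]]] := decT y Ty y0.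
  by exists b, d; rewrite TE.
split; first exact: (base_rigid_adjoin FT rT xf Tx).
move=> y Dy y0; have [k [c [d [Tc Dd d0 yE]]]] := adjoin_decomposition FT rT xf Tx Dy y0.
have c0 : c != 0 by apply: contraNneq y0 => c0; rewrite yE c0 mulr0 mul0r.
have [b [e [[b' [b'0 bb']] Te e0 cE]]] := decT c Tc c0.
exists (x ^+ k * b), (e * d); split.
- exists (f ^+ k * b'); rewrite mulf_neq0 ?expf_neq0 //.
  by rewrite exprMn exprAC xf bb' rmorphM rmorphXn.
- by rewrite rpredM // adjoin_sub.
- by rewrite mulf_neq0.
by rewrite yE cE exprMn !mulrA.
Qed.

(** The outermost generator [y] is removed first: [x = y^k d] with [d] in the smaller tower, and
    [d ^+ p] stays in [S] because [y ^+ p] comes from [F]. *)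
Lemma pow_in_tower S l x : contains_base S -> {in l, forall x, kummer_elt x} ->
  x \in adjoins S l -> x ^+ p \in S -> x != 0 ->
  exists b d, [/\ b != 0, d \in S & x ^+ p = iota b * d ^+ p].
Proof.
move=> FS; elim: l x => [|y l IH] x kl Tx Sxp x0.
  by exists 1, x; rewrite oner_neq0 rmorph1 mul1r.
have FT : contains_base (adjoins S l) by move=> b; apply: adjoins_sub.
have [f [f0 yf]] := kl y (mem_head _ _).
have y0 : y != 0 by apply: contraNneq f0 => y0; rewrite -(fmorph_eq0 iota) -yf y0 expr0n gtn_eqF.
have [|||k [d [Td d0 xE]]] := kummer_root sepL pp zP FT (base_z FT) (x := y) (y := x) _ y0 Tx => //.
- by rewrite yf FT.
- exact: adjoins_sub.
have dE : d ^+ p = x ^+ p / (y ^+ p) ^+ k.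
  by rewrite xE exprMn (exprAC y) mulrAC divff ?mul1r // !expf_neq0.
have [||||b [e [b0 Se dE']]] := IH d => //.
- by move=> u ul; apply: kl; rewrite inE ul orbT.
- by rewrite dE yf rpredM // rpredV rpredX.
exists (f ^+ k * b), e; split=> //; first by rewrite mulf_neq0 ?expf_neq0.
by rewrite xE exprMn dE' exprAC yf rmorphM rmorphXn mulrA.
Qed.
End Rigidity.

(** * The fields F^(2), F^(3) and F^{3} *)

(** The powers of any [p]-th root [beta] of [a] form an eigenvector of the multiplication matrix. *)
Lemma normmx_eigen (L : fieldType) p (a : L) (c : nat -> L) beta (j : 'I_p) :
  beta ^+ p = a -> \sum_(k < p) normmx p a c j k * beta ^+ k =
  beta ^+ j * \sum_(i < p) c i * beta ^+ i.
Proof.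
move=> betap; have jp : (j <= p)%N := ltnW (ltn_ord j).
pose G k := (if (j <= k)%N then c (k - j)%N else a * c (k + p - j)%N) * beta ^+ k.
rewrite (eq_bigr (fun k : 'I_p => G k)) => [|k _]; last by rewrite mxE.
rewrite -(big_mkord xpredT G) -(big_mkord xpredT (fun i => c i * beta ^+ i)).
(* Columns [k >= j] carry the coefficients of index below [p - j]; columns [k < j] carry the wrapped
   ones, where [a * beta ^+ k] is [beta ^+ (k + p)]. *)
rewrite (big_cat_nat (leq0n j) jp) [in RHS](big_cat_nat (leq0n (p - j)) (leq_subr j p)) /=.
rewrite mulrDr addrC; congr (_ + _); rewrite mulr_sumr.
  rewrite -[X in \sum_(X <= _ < _) _]add0n big_addn; apply: eq_bigr => k _.
  by rewrite /G leq_addl addnK addnC exprD; ring.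
rewrite -[X in \sum_(X <= _ < p) _]add0n big_addn subKn //.
rewrite big_nat_cond [RHS]big_nat_cond; apply: eq_bigr => k; rewrite andbT => /andP[_ kj].
rewrite /G leqNgt kj /= -betap addnBA // -(addnBA k jp) addnC.
rewrite (_ : beta ^+ p = beta ^+ j * beta ^+ (p - j)); last by rewrite -exprD subnKC.
rewrite exprD; ring.
Qed.

(** The Vandermonde matrix of the [p] distinct roots [z^s theta] diagonalizes [normmx p a c]. *)
Lemma det_normmx (L : fieldType) p (z a : L) (c : nat -> L) theta :
  p.-primitive_root z -> theta != 0 -> theta ^+ p = a ->
  \det (normmx p a c) = \prod_(s < p) (\sum_(i < p) c i * (z ^+ s * theta) ^+ i).
Proof.
move=> zP th0 tha; pose r := \row_(s < p) (z ^+ s * theta).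
pose d := \row_(s < p) (\sum_(i < p) c i * (z ^+ s * theta) ^+ i).
have E : normmx p a c *m Vandermonde p r = Vandermonde p r *m diag_mx d.
  apply/matrixP => j s; rewrite mul_mx_diag !mxE.
  rewrite (eq_bigr (fun k => normmx p a c j k * (z ^+ s * theta) ^+ k)) => [|k _]; last by rewrite !mxE.
  rewrite normmx_eigen // exprMn exprAC (prim_expr_order zP) expr1n mul1r //.
have V0 : \det (Vandermonde p r) != 0.
  rewrite det_Vandermonde; apply/prodf_neq0 => i _; apply/prodf_neq0 => j ij.
  rewrite !mxE -mulrBl mulf_neq0 // subr_eq0 (eq_prim_root_expr zP) !modn_small //.
  by rewrite gtn_eqF.
apply: (mulIf V0); rewrite -det_mulmx E det_mulmx det_diag mulrC; congr (_ * _).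
by apply: eq_bigr => s _; rewrite mxE.
Qed.

Lemma map_normmx (F L : fieldType) (iota : {rmorphism F -> L}) p a (c : nat -> F) :
  map_mx iota (normmx p a c) = normmx p (iota a) (fun i => iota (c i)).
Proof. by apply/matrixP => j k; rewrite !mxE; case: ifP => // _; rewrite rmorphM. Qed.

Lemma irreducible_dvd (K L : fieldType) (i : {rmorphism K -> L}) (f P : {poly K}) x :
  irreducible_poly f -> root (map_poly i f) x -> root (map_poly i P) x -> f %| P.
Proof.
move=> irf fx Px; have f0 := irredp_neq0 irf.
have [q [q0 qx qmin]] := exists_minimal_poly (ex_intro _ f (conj f0 fx)).
have q1 : size q != 1%N.
  by rewrite neq_ltn -(size_map_poly i) (@root_size_gt1 _ x) ?orbT ?map_poly_eq0.
by rewrite -(eqp_dvdl _ (irf q q1 (qmin f fx))) qmin.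
Qed.

Lemma minimal_irreducible (K L : fieldType) (i : {rmorphism K -> L}) (q : {poly K}) x :
  q != 0 -> root (map_poly i q) x -> (forall P, root (map_poly i P) x -> q %| P) ->
  irreducible_poly q.
Proof.
move=> q0 qx qmin; split.
  by rewrite -(size_map_poly i) (@root_size_gt1 _ x) ?map_poly_eq0.
move=> u u1 uq; have [v vE] := dvdpP _ _ uq.
have /andP[v0 u0] : (v != 0) && (u != 0) by rewrite -negb_or -mulf_eq0 -vE.
move: qx; rewrite vE rmorphM rootM => /orP[/qmin qv | /qmin qu]; last by rewrite /eqp -vE uq qu.
have := dvdp_leq v0 qv; rewrite vE size_mul // (polySpred u0) addnS /=.
rewrite -[X in (_ <= X)%N]addn0 leq_add2l leqn0 => /eqP su.
by rewrite (polySpred u0) su in u1.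
Qed.

(** * Rigidity against equality of the two third-level fields *)

Section Statement.
Variables (F L : fieldType) (iota : {rmorphism F -> L}) (p : nat) (zF : F).
Hypotheses (sepL : is_sep_closure iota) (pp : prime p) (op : odd p).
Hypothesis (zFP : p.-primitive_root zF).
Let z := iota zF.
Let zP : p.-primitive_root z. Proof. by rewrite fmorph_primitive_root. Qed.
Let Fz : exists a, z = iota a. Proof. by exists zF. Qed.
Let p0 : (0 < p)%N := prime_gt0 pp.
Local Notation kummer := (kummer_elt iota p).
Local Notation contains_base := (contains_base iota).

Definition base : divringClosed L := generated (inF iota).
Definition K2 : divringClosed L :=
  generated (fun y => inF iota y \/ exists a : F, a != 0 /\ y ^+ p = iota a).
Definition K3 : divringClosed L := generated (fun y => F2 iota p y \/
  exists g, [/\ F2 iota p g, g != 0, y ^+ p = g, ~ (exists h, F2 iota p h /\ g = h ^+ p)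
    & galois_over iota (gen (fun z => F2 iota p z \/ z = y))]).

Lemma baseP x : reflect (exists a, x = iota a) (x \in base).
Proof.
apply: (iffP (generatedP _ _)) => [/(_ (inF iota))|[a ->] S _]; last by apply; exists a.
apply=> //; split.
- by exists 0; rewrite rmorph0.
- by exists 1; rewrite rmorph1.
- by move=> _ _ [a ->] [b ->]; exists (a - b); rewrite rmorphB.
- by move=> _ _ [a ->] [b ->]; exists (a * b); rewrite rmorphM.
- by move=> _ [a ->]; exists a^-1; rewrite fmorphV.
Qed.

Lemma base_base : contains_base base. Proof. by move=> a; apply/baseP; exists a. Qed.

Lemma K2P x : reflect (F2 iota p x) (x \in K2). Proof. exact: generatedP. Qed.
Lemma K2_base : contains_base K2.
Proof. by move=> a; apply: generated_gen; left; exists a. Qed.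
Lemma K2_kummer x : kummer x -> x \in K2.
Proof. by move=> kx; apply: generated_gen; right. Qed.
Let K2z : z \in K2 := K2_base zF.

Lemma base_rigid_base : p_rigid F p -> base_rigid iota p z base.
Proof.
move=> rF f f0 nf theta c thf bc x0.
have /choice[c' c'E] : forall i, exists b, c i = iota b by move=> i; apply/baseP.
have th0 : theta != 0 by apply: contraNneq f0 => th0; rewrite -(fmorph_eq0 iota) -thf th0 expr0n gtn_eqF.
have ND : iota (\det (normmx p f c')) =
    \prod_(s < p) (\sum_(i < p) c i * (z ^+ s * theta) ^+ i).
  rewrite -det_map_mx map_normmx (det_normmx _ zP th0 thf).
  by apply: eq_bigr => s _; apply: eq_bigr => i _; rewrite c'E.
have [||k [_ [d [d0 E]]]] := rF f f0 _ (\det (normmx p f c')).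
- by move=> [b fE]; apply: nf; exists (iota b); rewrite base_base fE rmorphXn.
- exists c'; split=> //; apply: contrapT => nc; case/eqP: x0; apply: big1 => i _.
  have [ci0 | ci0] := eqVneq (c' i) 0; first by rewrite c'E ci0 rmorph0 mul0r.
  by case: nc; exists i.
exists k, (iota d); rewrite base_base fmorph_eq0; split=> //.
by rewrite -ND E rmorphM !rmorphXn.
Qed.

Lemma adjoins_cat (S : divringClosed L) l1 l2 :
  adjoins S (l1 ++ l2) = adjoins (adjoins S l2) l1.
Proof. by rewrite /adjoins foldr_cat. Qed.

(** An element of a generated field involves finitely many generators; two lists are merged by
    concatenation. *)
Lemma K2_tower x : x \in K2 -> exists l, {in l, forall y, kummer y} /\ x \in adjoins base l.
Proof.
move=> /generatedP/(_ (fun x => exists l, {in l, forall y, kummer y} /\ x \in adjoins base l)).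
apply.
  have join x1 x2 :
      (exists l, {in l, forall y, kummer y} /\ x1 \in adjoins base l) ->
      (exists l, {in l, forall y, kummer y} /\ x2 \in adjoins base l) ->
      exists l, [/\ {in l, forall y, kummer y}, x1 \in adjoins base l & x2 \in adjoins base l].
    move=> [l1 [k1 x1l]] [l2 [k2 x2l]]; exists (l1 ++ l2); split.
    - by move=> y; rewrite mem_cat => /orP[/k1 | /k2].
    - by rewrite adjoins_cat; apply: adjoinsS x1l; apply: adjoins_sub.
    - by rewrite adjoins_cat; apply: adjoins_sub.
  split.
  - by exists [::]; rewrite rpred0.
  - by exists [::]; rewrite rpred1.
  - by move=> x1 x2 h1 h2; have [l [kl ? ?]] := join x1 x2 h1 h2; exists l; rewrite rpredB.
  - by move=> x1 x2 h1 h2; have [l [kl ? ?]] := join x1 x2 h1 h2; exists l; rewrite rpredM.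
  - by move=> x1 [l [kl x1l]]; exists l; rewrite rpredV.
move=> y [[a ->] | ky]; first by exists [::]; rewrite base_base.
exists [:: y]; split; first by move=> u; rewrite inE => /eqP ->.
exact: adjoin_gen.
Qed.

Lemma K2_stable (t : {rmorphism L -> L}) : (forall a, t (iota a) = iota a) ->
  {in K2, forall x, t x \in K2}.
Proof.
move=> tF; apply: generated_morphism => y [[a ->] | [a [a0 ya]]].
  by rewrite tF K2_base.
by apply: K2_kummer; exists a; rewrite -rmorphXn ya tF.
Qed.

(** [t] multiplies each Kummer generator by a [p]-th root of unity, which it fixes: the Galois group
    of [K2] over [F] has exponent [p]. *)
Lemma K2_period (t : {rmorphism L -> L}) : (forall a, t (iota a) = iota a) ->
  {in K2, forall x, rpow t p x = x}.
Proof.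
move=> tF; apply: (generated_eq (h := idfun)) => y [[a ->] | [a [a0 ya]]].
  by rewrite rpow_fix.
have y0 : y != 0 by apply: contraNneq a0 => y0; rewrite -(fmorph_eq0 iota) -ya y0 expr0n gtn_eqF.
have : (t y / y) ^+ p = 1 by rewrite expr_div_n -rmorphXn ya tF divff // fmorph_eq0.
move=> /(prim_rootP zP)[j /(canRL (divfK y0)) tyE].
have tzj : t (z ^+ j) = z ^+ j by rewrite rmorphXn tF.
by rewrite (rpow_eigen p tzj tyE) exprAC (prim_expr_order zP) expr1n mul1r.
Qed.

Lemma fixed_base_root (f : {poly F}) (t : {rmorphism L -> L}) x :
  (forall a, t (iota a) = iota a) -> root (map_poly iota f) x -> root (map_poly iota f) (t x).
Proof.
move=> tF /rootP fx; apply/rootP.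
have <- : map_poly t (map_poly iota f) = map_poly iota f.
  by apply/polyP => k; rewrite !coef_map /= tF.
by rewrite horner_map fx rmorph0.
Qed.

Lemma conjugate_exists (f : {poly F}) x y : irreducible_poly f ->
  root (map_poly iota f) x -> root (map_poly iota f) y ->
  exists t : {rmorphism L -> L}, (forall a, t (iota a) = iota a) /\ t x = y.
Proof.
move=> irf fx fy; have [|t [tb txy]] := extend_morphism sepL base_base (x := x) (w := y).
  move=> P /polyOverP bP Px.
  have /choice[c cE] : forall k, exists b, P`_k = iota b by move=> k; apply/baseP.
  have PE : P = map_poly iota (\poly_(k < size P) c k).
    apply/polyP => k; rewrite coef_map coef_poly; case: ltnP => kP; first exact: cE.
    by rewrite nth_default //; exact: esym (rmorph0 iota).
  rewrite PE in Px *; have /dvdpP[Q ->] := irreducible_dvd irf fx Px.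
  by rewrite rmorphM rootM fy orbT.
by exists t; split=> // a; apply/tb/base_base.
Qed.

(** If [b] has no [p]-th root in [K2], then [K2(u)] is Galois over [F]: a conjugation [t] multiplies
    [b] by a power of [z], so [t u / u] is a [p]-th root of that power and lies in [K2]. *)
Lemma kummer_root_in_K3 b u : kummer b -> u ^+ p = b -> u \in K3.
Proof.
move=> [f [f0 bf]] ub; have K2b : b \in K2 by apply: K2_kummer; exists f.
have b0 : b != 0 by apply: contraNneq f0 => b0; rewrite -(fmorph_eq0 iota) -bf b0 expr0n gtn_eqF.
have K23 : {subset K2 <= K3} by move=> y /K2P y2; apply: generated_gen; left.
have rootK2 v w : v ^+ p = w ^+ p -> w != 0 -> w \in K2 -> v \in K2.
  move=> vw w0 K2w; have : (v / w) ^+ p = 1 by rewrite expr_div_n vw divff // expf_neq0.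
  by move=> /(prim_rootP zP)[j /(canRL (divfK w0)) ->]; rewrite rpredM ?rpredX.
case: (pselect (exists h, F2 iota p h /\ b = h ^+ p)) => [[h [/K2P K2h bh]] | nb].
  apply: K23; apply: (rootK2 u h) => //; first by rewrite ub.
  by apply: contraNneq b0 => h0; rewrite bh h0 expr0n gtn_eqF.
have u0 : u != 0 by apply: contraNneq b0 => u0; rewrite -ub u0 expr0n gtn_eqF.
apply: generated_gen; right; exists b; split=> //; first exact/K2P.
pose E := generated (fun z => F2 iota p z \/ z = u).
have K2E : {subset K2 <= E} by move=> y /K2P y2; apply: generated_gen; left.
split.
- exact: gen_subfield.
- by move=> c; apply/generatedP/K2E/K2_base.
- by move=> x _; case: sepL => /(_ x).
move=> g irg x /generatedP Ex gx y gy; apply/generatedP.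
have [t [tF <-]] := conjugate_exists irg gx gy.
apply: (generated_morphism (T := E) (g := t) _ Ex) => v [/K2P K2v | ->].
  exact/K2E/K2_stable.
have tbK : kummer (t b) by exists f; rewrite -rmorphXn bf tF.
have : (t b / b) ^+ p = 1 by rewrite expr_div_n -rmorphXn bf tF divff // fmorph_eq0.
move=> /(prim_rootP zP)[j jE].
have K2v : t u / u \in K2.
  apply: K2_kummer; exists (zF ^+ j); rewrite expf_neq0 ?(prim_root_eq0 zFP) -?lt0n //.
  by rewrite expr_div_n -rmorphXn ub jE rmorphXn.
rewrite -[t u](divfK u0) (rpredM (K2E _ K2v)) //.
by apply: generated_gen; right.
Qed.

(* Every [r] in [Gal(L/K2)] commutes with [t] on the generators of [K3], hence on [K3], so
   [r] fixes [t y / y]. *)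
Lemma K3_conjugate (t : {rmorphism L -> L}) y : (forall a, t (iota a) = iota a) ->
  y \in K3 -> y ^+ p \in K2 -> y != 0 -> t y / y \in K2.
Proof.
move=> tF K3y K2yp y0; have tz : t z = z by apply: tF.
have tK2 := K2_stable tF.
(* Normality puts [t v] in [K2(v)], so [t v = v^k d] by Kummer theory; the point is that [k] is 1
   modulo [p], which makes [t] commute on [v] with every morphism fixing [K2]. *)
have gen_case v g : F2 iota p g -> g != 0 -> v ^+ p = g ->
    ~ (exists h, F2 iota p h /\ g = h ^+ p) ->
    galois_over iota (gen (fun z => F2 iota p z \/ z = v)) -> exists2 d, d \in K2 & t v = d * v.
  move=> /K2P K2g g0 vg ng [_ _ _ normal].
  have K2v : v \notin K2.
    by apply/negP => /K2P v2; apply: ng; exists v.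
  have v0 : v != 0 by apply: contraNneq K2v => ->; apply: rpred0.
  have K2vp : v ^+ p \in K2 by rewrite vg.
  have [f [sepf fv]] := proj1 sepL v.
  have f0 : f != 0 := separable_poly_neq0 sepf.
  have [q [q0 qv qmin]] := exists_minimal_poly (ex_intro _ f (conj f0 fv)).
  have Ev : gen (fun z => F2 iota p z \/ z = v) v by apply/generatedP/generated_gen; right.
  have := normal q (minimal_irreducible q0 qv qmin) v Ev qv (t v) (fixed_base_root tF qv).
  move=> /generatedP Etv.
  have Atv : t v \in adjoin K2 v.
    by apply: generated_sub Etv => w [/K2P K2w | ->]; [apply: adjoin_sub | apply: adjoin_gen].
  have [||k [d [K2d d0 tvE]]] := kummer_root sepL pp zP K2_base K2z K2vp v0 Atv.
  - by rewrite -rmorphXn vg tK2.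
  - by rewrite fmorph_eq0.
  have iter_t n : exists2 e, e \in K2 & rpow t n v = v ^+ (k ^ n) * e.
    elim: n => [|n [e K2e IH]]; first by exists 1; rewrite ?rpred1 // expn0 mulr1.
    exists (d ^+ (k ^ n) * t e); first by rewrite rpredM ?tK2 ?rpredX.
    by rewrite rpowS IH rmorphM rmorphXn tvE exprMn -exprM -expnS mulrA.
  have [e K2e tpE] := iter_t p.
  have : (rpow t p v / v) ^+ p = 1.
    by rewrite expr_div_n -rmorphXn vg (K2_period tF) // divff.
  move=> /(prim_rootP zP)[j /(canRL (divfK v0))]; rewrite tpE => vE.
  have e0 : e != 0.
    apply: contra_eq_neq vE => ->; rewrite mulr0 eq_sym mulf_neq0 ?expf_neq0 //.
    by rewrite (prim_root_eq0 zP) -lt0n.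
  have k0 : (0 < k)%N.
    case: posnP vE => // ->; rewrite exp0n // mul1r => eE; case/negP: K2v.
    have -> : v = e / z ^+ j.
      by rewrite eE mulrC mulKf // expf_neq0 // (prim_root_eq0 zP) -lt0n.
    by rewrite rpredM ?rpredV ?rpredX.
  have pk : (p %| k ^ p - 1)%N.
    apply: contraNT K2v => npk; apply: (pow_in_of_coprime pp npk) => //.
    have -> : v ^+ (k ^ p - 1) = z ^+ j / e.
      apply: (mulIf v0); apply: (mulIf e0); rewrite -exprSr subn1 prednK ?expn_gt0 ?k0 //.
      by rewrite vE mulrAC divfK.
    by rewrite rpredM ?rpredV ?rpredX.
  (* [t^p] fixes [K2], hence multiplies [v] by a root of unity: [k^p = k = 1] modulo [p]. *)
  have : (p %| k - 1)%N.
    by rewrite -eqn_mod_dvd // -(fermat_little k pp) eqn_mod_dvd // expn_gt0 k0.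
  move=> /dvdnP[q' kE]; exists ((v ^+ p) ^+ q' * d).
    by rewrite rpredM // rpredX.
  by rewrite tvE -(subnK k0) kE exprD expr1 mulnC exprM; ring.
(* If [t y / y] were outside [K2], some [r] fixing [K2] would multiply it by [z]. *)
apply: contrapT => /negP K2w; have K2tyy : (t y / y) ^+ p \in K2.
  by rewrite expr_div_n -rmorphXn rpredM ?rpredV ?tK2.
have [r [rK2 rw]] := kummer_conjugation sepL pp zP K2_base K2z K2w K2tyy.
have rz : r z = z by apply: rK2.
have r_eig v : v ^+ p \in K2 -> v != 0 -> exists j : nat, r v = z ^+ j * v.
  move=> K2v v0; have : (r v / v) ^+ p = 1.
    by rewrite expr_div_n -rmorphXn rK2 // divff // expf_neq0.
  by move=> /(prim_rootP zP)[j /(canRL (divfK v0)) ->]; exists j.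
have comm : {in K3, forall v, r (t v) = t (r v)}.
  apply: (generated_eq (g := r \o t) (h := t \o r)) => v [/K2P K2v | ] /=.
    by rewrite (rK2 v) // rK2 // tK2.
  move=> [g [g2 g0 vg ng galv]]; have [d K2d tvE] := gen_case v g g2 g0 vg ng galv.
  have v0 : v != 0 by apply: contraNneq g0 => v0; rewrite -vg v0 expr0n gtn_eqF.
  have [|j rv] := r_eig v _ v0; first by rewrite vg; apply/K2P.
  by rewrite tvE rmorphM rv rK2 // rmorphM rmorphXn tz tvE mulrCA.
have [j ry] := r_eig y K2yp y0.
have : r (t y / y) = t y / y.
  rewrite fmorph_div comm // ry rmorphM rmorphXn tz -mulf_div divff ?mul1r //.
  by rewrite expf_neq0 // (prim_root_eq0 zP) -lt0n.
have w0 : t y / y != 0 by rewrite mulf_neq0 ?invr_eq0 ?fmorph_eq0.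
by rewrite rw -[X in _ = X]mul1r => /(mulIf w0)/eqP; apply/negP/(prim_neq1 pp zP).
Qed.

Lemma rigid_of_K3 : (forall x : L, F3curly iota p x -> F3 iota p x) -> p_rigid F p.
Proof.
move=> curly a a0 na b [c [[i0 [i0p ci0]] bE]].
have [al ala] : exists al, al ^+ p = iota a.
  by apply: (root_exists sepL pp zP); rewrite fmorph_eq0.
have al0 : al != 0 by apply: contraNneq a0 => al0; rewrite -(fmorph_eq0 iota) -ala al0 expr0n gtn_eqF.
have bal : al \notin base.
  apply/negP => /baseP[d dE]; apply: na; exists d; apply: (fmorph_inj iota).
  by rewrite -ala dE rmorphXn.
have balp : al ^+ p \in base by rewrite ala base_base.
have bz : z \in base := base_base zF.
have [t [tb tal]] := kummer_conjugation sepL pp zP base_base bz bal balp.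
have tF d : t (iota d) = iota d by apply/tb/base_base.
have tz : t z = z := tF zF.
pose K := adjoin base al; have bK : {subset base <= K} := @adjoin_sub _ base al.
have KF : contains_base K by move=> d; apply/bK/base_base.
have Kal : al \in K := adjoin_gen base al.
have [tK _] := adjoin_conj zP Fz base_base tb tal.
pose x := \sum_(i < p) iota (c i) * al ^+ i.
have Kx : x \in K by apply: rpred_sum => i _; rewrite rpredM ?(rpredX _ Kal).
have NxE : pnorm t p x = iota b.
  rewrite (pnorm_expansion p tz tal (fun i => tF (c i))) bE -det_map_mx map_normmx.
  by rewrite (det_normmx _ zP al0 ala).
have x0 : x != 0.
  (* If [x] were 0, the nonzero polynomial [P] of size at most [p] would have the [p] distinct roots
     [z^s al]. *)
  apply: contraNneq ci0 => x0; pose P := \poly_(i < p) iota (c i).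
  have Proot s : root P (z ^+ s * al).
    apply/rootP; have := congr1 (rpow t s) x0.
    rewrite (rmorph0 (rpow t s)) rmorph_sum => <-; rewrite horner_poly.
    apply: eq_bigr => i _; rewrite rmorphM rmorphXn (rpow_fix _ (tF _)).
    by rewrite (rpow_eigen _ tz tal).
  have P0 : P = 0.
    apply: contrapT => /eqP P0; have /negP[] : ~~ (p < p)%N by rewrite ltnn.
    apply: leq_trans (size_poly p (fun i => iota (c i))).
    rewrite -{1}(size_mkseq (fun s => z ^+ s * al) p); apply: max_poly_roots => //.
      by apply/allP => _ /mapP[s _ ->].
    apply/mkseq_uniqP => i j; rewrite !inE => ip jp /(mulIf al0)/eqP.
    by rewrite (eq_prim_root_expr zP) !modn_small // => /eqP.
  have := coef_poly p (fun i => iota (c i)) i0; rewrite i0p -/P P0 coef0 => /esym/eqP.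
  by rewrite fmorph_eq0.
have [y yx] := root_exists sepL pp zP x0.
have y0 : y != 0 by apply: contraNneq x0 => y0; rewrite -yx y0 expr0n gtn_eqF.
have K2al : al \in K2 by apply: K2_kummer; exists a.
have K2x : x \in K2 by apply: rpred_sum => i _; rewrite rpredM ?(rpredX _ K2al) ?K2_base.
have K3y : y \in K3.
  apply/generatedP; refine (curly y _) => S hS AS.
  by apply: AS; right; exists x; split=> //; apply/K2P.
have K2v := K3_conjugate tF K3y (_ : y ^+ p \in K2) y0.
rewrite yx in K2v; move: (K2v K2x) => {K2v}.
set v := t y / y => K2v.
have vE : v ^+ p = t x / x by rewrite expr_div_n -rmorphXn yx.
have v0 : v != 0 by rewrite mulf_neq0 ?invr_eq0 ?fmorph_eq0.
have [l [kl Tv]] := K2_tower K2v.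
(* The tower containing [v] is taken over [K] instead of [base], since [v ^+ p = t x / x] is only
   known to lie in [K]. *)
have [|e [d [e0 Kd vE']]] := pow_in_tower sepL pp zP Fz KF kl (adjoinsS bK Tv) _ v0.
  by rewrite vE rpredM ?rpredV ?tK.
have txE : t x = x * iota e * d ^+ p.
  by rewrite -mulrA -vE' vE mulrC divfK.
have iter_t n : exists2 w, w \in K & rpow t n x = x * iota e ^+ n * w ^+ p.
  elim: n => [|n [w Kw IH]]; first by exists 1; rewrite ?rpred1 // expr1n !mulr1.
  exists (d * t w); first by rewrite rpredM ?tK.
  by rewrite rpowS IH !rmorphM !rmorphXn tF txE exprMn exprS; ring.
have /choice[w wE] : forall n, exists w, w \in K /\ rpow t n x = x * iota e ^+ n * w ^+ p.
  by move=> n; have [w] := iter_t n; exists w.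
(* [r] is a [p]-th root of the product of the [x e^n w_n^p] over [n < p]: the exponents of [e] add
   up to [p * p.-1./2]. *)
pose r := x * iota e ^+ p.-1./2 * \prod_(n < p) w n.
have Kr : r \in K.
  rewrite !rpredM ?rpredX // rpred_prod // => n _; by case: (wE n).
have rE : r ^+ p = iota b.
  rewrite -NxE /pnorm; under eq_bigr => n _ do rewrite (proj2 (wE n)).
  rewrite !big_split /= prodr_const card_ord prodrXl -expr_sum.
  rewrite -(big_mkord xpredT id) bin2_sum bin2odd // /r !exprMn -exprM (mulnC p.-1./2).
  by [].
have b0 : b != 0 by rewrite -(fmorph_eq0 iota) -NxE pnorm_neq0.
have r0 : r != 0 by apply: contraNneq b0 => r0; rewrite -(fmorph_eq0 iota) -rE r0 expr0n gtn_eqF.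
have [|k [d' [/baseP[d'' d'E] d'0 rE']]] :=
  kummer_root sepL pp zP base_base bz balp al0 Kr _ r0.
  by rewrite rE base_base.
(* The full multiples of [p] in the exponent of [a] are moved into the [p]-th power. *)
exists (k %% p)%N; rewrite ltn_mod p0; split=> //.
exists (a ^+ (k %/ p) * d''); split.
  by rewrite mulf_neq0 ?expf_neq0 // -(fmorph_eq0 iota) -d'E.
apply: (fmorph_inj iota); rewrite -rE rE' d'E exprMn exprAC ala exprMn mulrA -exprM -exprD.
by rewrite addnC -divn_eq rmorphM !rmorphXn.
Qed.

Lemma curly_of_rigid : p_rigid F p -> forall x, F3curly iota p x -> F3 iota p x.
Proof.
move=> rF x; apply=> [|y [y2 | [g [/K2P K2g g0 yg]]]]; first exact: gen_subfield.
  by apply/(generatedP _ _); apply: generated_gen; left.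
have rb := base_rigid_base rF.
have decb u : u \in base -> u != 0 ->
    exists b d, [/\ kummer b, d \in base, d != 0 & u = b * d ^+ p].
  move=> /baseP[f ->]; rewrite fmorph_eq0 => f0; exists (iota f), 1.
  rewrite rpred1 oner_neq0 expr1n mulr1; split=> //.
  by exists (f ^+ p); rewrite expf_neq0 // rmorphXn.
have [l [kl Tg]] := K2_tower K2g.
have [_ /(_ g Tg g0)[b [d [kb Td d0 gE]]]] :=
  tower_decomposition sepL pp op zP Fz base_base rb decb kl.
have K2d : d \in K2.
  elim: (l) kl d Td {d0 gE Tg} => [|u l' IH] kl d Td.
    by have /baseP[a ->] := Td; apply: K2_base.
  apply: adjoin_least Td => [v Tv | ]; last by apply/K2_kummer/kl/mem_head.
  by apply: IH Tv => w wl; apply: kl; rewrite inE wl orbT.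
(* Up to the factor [d] in [K2], [y] is a [p]-th root of the Kummer element [b]. *)
have ub : (y / d) ^+ p = b by rewrite expr_div_n yg gE mulfK // expf_neq0.
apply/(generatedP _ _); rewrite -[y](divfK d0) rpredM //.
  exact: kummer_root_in_K3 kb ub.
by apply: generated_gen; left; apply/K2P.
Qed.

Lemma F3_curly x : F3 iota p x -> F3curly iota p x.
Proof.
apply=> [|y [y2 | [g [g2 g0 yg _ _]]] S hS AS]; first exact: gen_subfield.
  by apply: AS; left.
by apply: AS; right; exists g.
Qed.
End Statement.

Theorem theoremA (F L : fieldType) (iota : {rmorphism F -> L}) (p : nat) :
  prime p -> odd p -> (exists z : F, p.-primitive_root z) ->
  is_sep_closure iota ->
  (p_rigid F p <-> (forall x : L, F3 iota p x <-> F3curly iota p x)).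
Proof.
move=> pp op [zF zFP] sepL; split=> [rF x | E].
  by split; [apply: F3_curly | apply: (curly_of_rigid sepL pp op zFP rF)].
by apply: (rigid_of_K3 sepL pp op zFP) => x /E.
Qed.
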